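(* Let $A$ be an Artin algebra with Jacobson radical $J$. The statements below are equivalent: (1) $\operatorname{inj\,dim}_A A=\operatorname{inj\,dim}_{A^{\mathrm{op}}}A$; (2) $\operatorname{Ginj\,dim}_A J=\operatorname{inj\,dim}_A A$ and $\operatorname{Ginj\,dim}_{A^{\mathrm{op}}}J=\operatorname{inj\,dim}_{A^{\mathrm{op}}}A$. When they hold, $\operatorname{Ginj\,dim}_A J=\operatorname{Ginj\,dim}_{A^{\mathrm{op}}}J$.
   Context: An Artin algebra is an algebra $A$ over a commutative artinian ring $R$ (with the image of $R$ central) that is finitely generated as an $R$-module. Modules are left modules; modules over the opposite ring $A^{\mathrm{op}}$ are right $A$-modules. An $A$-module $G$ is Gorenstein injective if it is a kernel of a differential in an exact (two-sided unbounded) complex $I$ of injective $A$-modules such that $\operatorname{Hom}_A(E,I)$ is exact for every injective $A$-module $E$. $\operatorname{Ginj\,dim}_A M$ is the least $n\ge 0$ for which there is an exact sequence $0\to M\to G^0\to\cdots\to G^n\to 0$ with all $G^i$ Gorenstein injective, and $\infty$ if there is none. All equalities are in $\{0,1,2,\dots\}\cup\{\infty\}$, and the zero module has dimension $0$. *)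

(* Defs.v *)
From HB Require Import structures.
From mathcomp Require Import all_boot all_order all_algebra.
From mathcomp Require Import boolp.

Set Implicit Arguments.
Unset Strict Implicit.
Unset Printing Implicit Defensive.

Import GRing.Theory.
Local Open Scope ring_scope.

(* Left A-modules are [lmodType A], right A-modules are [lmodType A^c], where
   [A^c] is the opposite ring; the left and right regular modules are [A^o]
   and [(A^c)^o].  Rings are [pzRingType]s, so the zero ring is allowed. *)

Definition left_ideal (A : pzRingType) (I : {pred A}) : Prop :=
  @submod_closed A A^o I.

Definition artinian (R : comPzRingType) : Prop :=
  forall I : nat -> {pred R},
    (forall n, left_ideal (I n)) ->
    (forall n, {subset I n.+1 <= I n}) ->
    exists n, forall m, (n <= m)%N -> I m =i I n.

(* [phi] is the structure map of the R-algebra A. *)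
Definition artin_algebra (R : comPzRingType) (A : pzRingType)
    (phi : {rmorphism R -> A}) : Prop :=
  [/\ artinian R,
      forall r a, phi r * a = a * phi r &
      exists (n : nat) (g : 'I_n -> A), forall a : A,
        exists c : 'I_n -> R, a = \sum_(i < n) phi (c i) * g i].

Definition maximal_left_ideal (A : pzRingType) (I : {pred A}) : Prop :=
  [/\ left_ideal I, ~ (I =i predT) &
      forall K : {pred A}, left_ideal K -> {subset I <= K} ->
        K =i I \/ K =i predT].

Definition jacobson (A : pzRingType) : {pred A} :=
  fun x => `[< forall I : {pred A}, maximal_left_ideal I -> x \in I >].
Arguments jacobson : clear implicits.

Lemma jacobsonP (A : pzRingType) (x : A) :
  reflect (forall I : {pred A}, maximal_left_ideal I -> x \in I)
          (x \in jacobson A).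
Proof. exact: asboolP. Qed.

Lemma jacobson_left (A : pzRingType) : @submod_closed A A^o (jacobson A).
Proof.
split; first by apply/jacobsonP => I [[]].
move=> a u v /jacobsonP Ju /jacobsonP Jv; apply/jacobsonP => I mI.
by case: (mI) => [[_ lI] _ _]; apply: lI; [apply: Ju | apply: Jv].
Qed.

Lemma jacobson_mulr (A : pzRingType) (x a : A) :
  x \in jacobson A -> x * a \in jacobson A.
Proof.
move=> /jacobsonP Jx; apply/jacobsonP => I [[I0 lI] pI mI].
have [aI | naI] := boolP (a \in I).
  by have := lI x _ _ aI I0; rewrite addr0.
pose L : {pred A} := fun y => y * a \in I.
have ID y z : y \in I -> z \in I -> y + z \in I.
  by move=> yI zI; have := lI 1 _ _ yI zI; rewrite scale1r.
have IM c y : y \in I -> c * y \in I.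
  by move=> yI; have := lI c _ _ yI I0; rewrite addr0.
have lL : left_ideal L.
  split; first by rewrite unfold_in mul0r.
  move=> c u v; rewrite !unfold_in => uL vL.
  by rewrite mulrDl -mulrA; apply: ID => //; apply: IM.
suff : maximal_left_ideal L by move/Jx.
split=> //.
  by move/(_ 1); rewrite unfold_in mul1r (negPf naI).
move=> K [K0 lK] LK.
have KD y z : y \in K -> z \in K -> y + z \in K.
  by move=> yK zK; have := lK 1 _ _ yK zK; rewrite scale1r.
have KM c y : y \in K -> c * y \in K.
  by move=> yK; have := lK c _ _ yK K0; rewrite addr0.
have [KL | nKL] := pselect ({subset K <= L}).
  by left=> y; apply/idP/idP; [apply: KL | apply: LK].
right.
pose I' : {pred A} := fun z => `[< exists y k, [/\ y \in I, k \in K &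
                                     z = y + k * a] >].
have I'l : left_ideal I'.
  split; first by apply/asboolP; exists 0, 0; rewrite mul0r addr0.
  move=> c u v /asboolP [y [k [yI kK ->]]] /asboolP [z [l [zI lK' ->]]].
  apply/asboolP; exists (c * y + z), (c * k + l); split.
  - by apply: ID => //; apply: IM.
  - by apply: KD => //; apply: KM.
  - rewrite /GRing.scale /= mulrDr mulrDl !mulrA.
    by rewrite -!addrA; congr (_ + _); rewrite addrCA.
have II' : {subset I <= I'}.
  by move=> y yI; apply/asboolP; exists y, 0; rewrite mul0r addr0.
case: (mI I' I'l II') => [E | E].
  case: nKL => k kK; rewrite unfold_in -E; apply/asboolP.
  by exists 0, k; rewrite add0r.
have /asboolP [y [k [yI kK aE]]] : a \in I' by rewrite E.
have K1 : 1 - k \in K.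
  apply: LK; rewrite unfold_in mulrBl mul1r {1}aE addrK //.
move=> z; rewrite inE; have := KM z _ (KD _ _ K1 kK).
by rewrite subrK mulr1.
Qed.

Lemma jacobson_right (A : pzRingType) : @submod_closed A^c (A^c)^o (jacobson A).
Proof.
have [J0 lJ] := jacobson_left A; split=> // a u v Ju Jv.
have := lJ 1 _ _ (@jacobson_mulr A u a Ju) Jv.
by rewrite scale1r.
Qed.

Section Submodule.
Variables (A : pzRingType) (V : lmodType A) (S : {pred V}).

Definition submod_pred (hS : submod_closed S) : {pred V} := S.

HB.instance Definition _ (hS : submod_closed S) :=
  GRing.isSubmodClosed.Build A V (submod_pred hS) hS.

Definition submodule (hS : submod_closed S) : Type :=
  {x : V | submod_pred hS x}.

HB.instance Definition _ (hS : submod_closed S) :=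
  SubChoice.on (submodule hS).
HB.instance Definition _ (hS : submod_closed S) :=
  [SubChoice_isSubLmodule of submodule hS by <:].

End Submodule.

Definition radical_left (A : pzRingType) : lmodType A :=
  submodule (jacobson_left A).

Definition radical_right (A : pzRingType) : lmodType A^c :=
  submodule (jacobson_right A).

Section Homological.
Variable A : pzRingType.

Definition exact_at (U V W : lmodType A) (f : U -> V) (g : V -> W) : Prop :=
  forall y, g y = 0 <-> exists x, f x = y.

Definition injective_module (E : lmodType A) : Prop :=
  forall (M N : lmodType A) (f : {linear M -> N}) (g : {linear M -> E}),
    injective f -> exists h : {linear N -> E}, forall x, h (f x) = g x.

(* The degree of a complex is shifted by [1 + i] rather than [i + 1], because
   the former computes on the constructors of [int]. *)
Definition exact_complex (I : int -> lmodType A)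
    (d : forall i, {linear I i -> I (1 + i)}) : Prop :=
  forall i, exact_at (d i) (d (1 + i)).

(* Exactness of Hom_A(E, I), whose differentials are composition with those
   of I. *)
Definition exact_Hom_complex (E : lmodType A) (I : int -> lmodType A)
    (d : forall i, {linear I i -> I (1 + i)}) : Prop :=
  forall (i : int) (h : {linear E -> I (1 + i)}),
    (forall x, d (1 + i) (h x) = 0) <->
    exists g : {linear E -> I i}, forall x, d i (g x) = h x.

Definition gorenstein_injective (G : lmodType A) : Prop :=
  exists (I : int -> lmodType A) (d : forall i, {linear I i -> I (1 + i)}),
    [/\ forall i, injective_module (I i),
        exact_complex d,
        forall E, injective_module E -> exact_Hom_complex E d &
        exists (k : int) (u : {linear G -> I k}),
          injective u /\ exact_at u (d k)].

(* An exact sequence 0 -> M -> G 0 -> ... -> G n -> 0 with terms in P, padded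
   with zero modules to the right of G n. *)
Definition coresolution (P : lmodType A -> Prop) (M : lmodType A) (n : nat) :
    Prop :=
  exists (G : nat -> lmodType A) (e : {linear M -> G 0%N})
         (d : forall i, {linear G i -> G i.+1}),
    [/\ forall i, (i <= n)%N -> P (G i),
        forall i, (n < i)%N -> forall x : G i, x = 0,
        injective e,
        exact_at e (d 0%N) &
        forall i, exact_at (d i) (d i.+1)].

Lemma coresolution_asbool P M :
  (exists n, coresolution P M n) -> exists n, `[< coresolution P M n >].
Proof. by case=> n h; exists n; apply/asboolP. Qed.

(* The least length of a coresolution; [None] stands for infinity. *)
Definition codim (P : lmodType A -> Prop) (M : lmodType A) : option nat :=
  if pselect (exists n, coresolution P M n) is left h
  then Some (ex_minn (coresolution_asbool h)) else None.

Definition injdim : lmodType A -> option nat := codim injective_module.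
Definition Ginjdim : lmodType A -> option nat := codim gorenstein_injective.

End Homological.

(* Main.v *)
Require Import Defs.
From HB Require Import structures.
From mathcomp Require Import all_boot all_order all_algebra.
From mathcomp Require Import boolp classical_sets functions zify.

(* The key point is that a left module X with Ext^1(X, J) = 0 is projective
   (lemma ext1_radical_projective).  If the left module J has Gorenstein
   injective dimension at most n and E is an injective left module, then
   Ext^{n+1}(E, J) = 0 by dimension shifting, so the n-th syzygy of E is
   projective and Tor_{n+1}(N, E) = 0 for every finitely generated right module
   N.  As E ranges over all injective modules, this is equivalent to
   Ext^{n+1}(N, A) = 0 for right modules, whence injdim A^op <= Ginjdim J for
   the left module J, and symmetrically injdim A <= Ginjdim J for the right
   module J.  Together with (2) these two inequalities give (1).

   Conversely, let both self-injective dimensions equal n (if they are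
   infinite, the two inequalities suffice).  Then n-th syzygies of injective
   left modules are projective, since Tor_{n+1}(A/J, E) = 0, and n-th
   cosyzygies of free left modules are injective.  Hence the n-th cosyzygy of
   any left module is Gorenstein injective, so Ginjdim J <= n. *)

Set Implicit Arguments.
Unset Strict Implicit.
Unset Printing Implicit Defensive.

Import Order.TTheory GRing.Theory Num.Theory.
Local Open Scope ring_scope.

(** * Linear maps, submodules and quotients *)

(** Only vanishing statements about Ext and Tor occur, and no groups are built. For an arbitrary
    first argument, Ext^1 is an extension problem along a chosen free cover; for a cyclic module
    A/L, it is the solvability of linear systems given by a resolution by matrices. In the second
    form, Ext of A/L with values in the regular module and Tor of A/L with E involve the same
    matrices, transposed. Cyclic modules suffice because Baer's criterion tests injectivity on
    ideals, and A/J alone tests projectivity since J is nilpotent with A/J semisimple. The injective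
    modules E are arbitrary, so their syzygies may be infinitely generated; nilpotency of J replaces
    Nakayama's lemma for finitely generated modules. The base ring enters by making A artinian on
    both sides. *)

Section LinearMaps.
Variable A : pzRingType.
Implicit Types (U V W M N C X : lmodType A).

Lemma linear_of_fun V W (f : V -> W) :
  (forall a u v, f (a *: u + v) = a *: f u + f v) ->
  exists g : {linear V -> W}, forall v, g v = f v.
Proof.
move=> fl; have fl' : linear f by [].
by exists (HB.pack_for {linear V -> W} f (GRing.isLinear.Build _ _ _ _ f fl')).
Qed.

(** Functionality needs checking at 0 only, since two values at [v] differ by a value at 0. Maps out
    of quotients, into submodules and on free modules are obtained from their graphs in this way. *)
Lemma linear_of_rel V W (G : V -> W -> Prop) :
  (forall v, exists w, G v w) ->
  (forall a v w v' w', G v w -> G v' w' -> G (a *: v + v') (a *: w + w')) ->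
  (forall w, G 0 w -> w = 0) ->
  exists f : {linear V -> W}, forall v, G v (f v).
Proof.
move=> /choice [f Gf] Gl G0.
have Guniq v w w' : G v w -> G v w' -> w = w'.
  move=> Gw Gw'; apply/eqP; rewrite -subr_eq0; apply/eqP/G0.
  have := Gl (-1) _ _ _ _ Gw' Gw; rewrite !scaleN1r addNr.
  by rewrite addrC.
have [|g gf] := @linear_of_fun V W f.
  by move=> a u v; apply: (Guniq _ _ _ (Gf _)); apply: Gl.
by exists g => v; rewrite gf.
Qed.

Definition onto V W (f : V -> W) := forall w, exists v, f v = w.

Definition ses M N C (i : {linear M -> N}) (p : {linear N -> C}) :=
  [/\ injective i, onto p & exact_at i p].

Lemma ses0 M N C (i : {linear M -> N}) (p : {linear N -> C}) x :
  ses i p -> p (i x) = 0.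
Proof. by case=> _ _ ex; apply/ex; exists x. Qed.

Lemma linear_inj0 V W (f : {linear V -> W}) :
  (forall x, f x = 0 -> x = 0) -> injective f.
Proof.
move=> f0 x y fxy; apply/eqP; rewrite -subr_eq0; apply/eqP/f0.
by rewrite linearB fxy subrr.
Qed.

Lemma factor_onto U V W (p : {linear V -> W}) (f : {linear V -> U}) :
  onto p -> (forall v, p v = 0 -> f v = 0) ->
  exists g : {linear W -> U}, forall v, g (p v) = f v.
Proof.
move=> ps pf.
have [||w [v [pv <-]]|g gP] :=
    @linear_of_rel W U (fun w u => exists v, p v = w /\ f v = u).
- by move=> w; have [v pv] := ps w; exists (f v), v.
- move=> a _ _ _ _ [v [<- <-]] [v' [<- <-]].
  by exists (a *: v + v'); rewrite !linearP.
- exact: pf.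
exists g => v; have [v' [pv' <-]] := gP (p v).
apply/eqP; rewrite -subr_eq0 -linearB; apply/eqP/pf.
by rewrite linearB pv' subrr.
Qed.

Lemma factor_inj V N M (i : {linear M -> N}) (f : {linear V -> N}) :
  injective i -> (forall v, exists m, i m = f v) ->
  exists g : {linear V -> M}, forall v, i (g v) = f v.
Proof.
move=> ii fi.
have [//|||g gP] := @linear_of_rel V M (fun v m => i m = f v).
- by move=> a v w v' w' ew ew'; rewrite !linearP ew ew'.
- by move=> w; rewrite linear0 -(linear0 i) => /ii.
by exists g.
Qed.

Definition smod V (S : V -> Prop) :=
  S 0 /\ forall a u v, S u -> S v -> S (a *: u + v).

Section Smod.
Variables (V : lmodType A) (S : V -> Prop) (hS : smod S).

Lemma smod0 : S 0. Proof. by case: hS. Qed.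

Lemma smodZ a u : S u -> S (a *: u).
Proof. by case: hS => S0 Sl /(Sl a) /(_ S0); rewrite addr0. Qed.

Lemma smodD u v : S u -> S v -> S (u + v).
Proof. by case: hS => _ Sl Su /(Sl 1 _ _ Su); rewrite scale1r. Qed.

Lemma smodN u : S u -> S (- u).
Proof. by move/(smodZ (-1)); rewrite scaleN1r. Qed.

Lemma smodB u v : S u -> S v -> S (u - v).
Proof. by move=> Su /smodN; apply: smodD. Qed.

Lemma smod_sum I (r : seq I) (P : pred I) (f : I -> V) :
  (forall i, P i -> S (f i)) -> S (\sum_(i <- r | P i) f i).
Proof. by move=> Sf; apply: big_ind; [exact: smod0|exact: smodD|]. Qed.

End Smod.

Lemma smod_closed V (S : V -> Prop) :
  smod S -> submod_closed (fun v => `[< S v >] : bool).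
Proof.
case=> S0 Sl; split; first exact/asboolP.
by move=> a u v /asboolP Su /asboolP Sv; apply/asboolP/Sl.
Qed.

Lemma submodule_ex V (S : V -> Prop) : smod S ->
  exists (M : lmodType A) (i : {linear M -> V}),
    injective i /\ forall v, S v <-> exists m, i m = v.
Proof.
move=> hS; pose M : lmodType A := submodule (smod_closed hS).
have [|i iE] := @linear_of_fun M V (fun x => val x); first by [].
exists M, i; split; first by move=> x y; rewrite !iE => /val_inj.
move=> v; split; last by case=> m <-; rewrite iE; exact/asboolP/(valP m).
move=> Sv; have Pv : submod_pred (smod_closed hS) v by exact/asboolP.
by exists (exist _ v Pv : submodule (smod_closed hS)); rewrite iE.
Qed.

End LinearMaps.

Section Quotient.
Variables (A : pzRingType) (V : lmodType A) (S : V -> Prop) (hS : smod S).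

(** The representative depends on the coset alone: congruent elements give extensionally equal
    predicates, on which [choose] returns the same witness. The quotient is then the set of fixed
    points. *)
Definition quo_repr (v : V) : V := choose (fun w => `[< S (w - v) >]) v.

Lemma quo_reprP v : S (quo_repr v - v).
Proof.
have Pv : `[< S (v - v) >] by apply/asboolP; rewrite subrr; exact: smod0 hS.
exact/asboolP/(@chooseP _ (fun w => `[< S (w - v) >]) v Pv).
Qed.

Lemma quo_repr_eq v w : quo_repr v = quo_repr w <-> S (v - w).
Proof.
split=> [e|Svw].
  have := smodB hS (quo_reprP w) (quo_reprP v).
  by rewrite e opprB addrC addrA subrK.
have e : (fun u => `[< S (u - v) >]) =1 (fun u => `[< S (u - w) >]).
  move=> u; apply: asbool_equiv_eq; split=> h.
    by have := smodD hS h Svw; rewrite addrA subrK.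
  by have := smodB hS h Svw; rewrite opprB addrA subrK.
rewrite /quo_repr (eq_choose e); apply: choose_id; apply/asboolP.
  by [].
by rewrite subrr; exact: smod0 hS.
Qed.

Lemma quo_repr_id v : quo_repr (quo_repr v) == quo_repr v.
Proof. exact/eqP/quo_repr_eq/quo_reprP. Qed.

Definition quotient (_ : smod S) : Type := {v : V | quo_repr v == v}.
HB.instance Definition _ := Choice.on (quotient hS).
Local Notation quo := (quotient hS).

Definition quo_pi (v : V) : quo := exist _ (quo_repr v) (quo_repr_id v).

Lemma quo_piP v w : quo_pi v = quo_pi w <-> S (v - w).
Proof.
split=> [/(congr1 val) /quo_repr_eq //|Svw].
exact/val_inj/quo_repr_eq.
Qed.

Lemma quo_piK (x : quo) : quo_pi (val x) = x.
Proof. by apply: val_inj; apply/eqP; exact: (valP x). Qed.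

Lemma quo_val_pi v : S (val (quo_pi v) - v).
Proof. exact: quo_reprP. Qed.

Definition quo_add (x y : quo) := quo_pi (val x + val y).
Definition quo_opp (x : quo) := quo_pi (- val x).
Definition quo_scale a (x : quo) := quo_pi (a *: val x).

Lemma quo_addE v w : quo_add (quo_pi v) (quo_pi w) = quo_pi (v + w).
Proof.
apply/quo_piP; rewrite opprD addrACA.
by apply: (smodD hS); apply: quo_val_pi.
Qed.

Lemma quo_oppE v : quo_opp (quo_pi v) = quo_pi (- v).
Proof. by apply/quo_piP; rewrite -opprD; apply/(smodN hS)/quo_val_pi. Qed.

Lemma quo_scaleE a v : quo_scale a (quo_pi v) = quo_pi (a *: v).
Proof. by apply/quo_piP; rewrite -scalerBr; apply/(smodZ hS)/quo_val_pi. Qed.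

Lemma quo_ind (P : quo -> Prop) : (forall v, P (quo_pi v)) -> forall x, P x.
Proof. by move=> h x; rewrite -(quo_piK x). Qed.

Fact quo_addA : associative quo_add.
Proof.
by elim/quo_ind=> x; elim/quo_ind=> y; elim/quo_ind=> z;
  rewrite !quo_addE addrA.
Qed.

Fact quo_addC : commutative quo_add.
Proof. by elim/quo_ind=> x; elim/quo_ind=> y; rewrite !quo_addE addrC. Qed.

Fact quo_add0 : left_id (quo_pi 0) quo_add.
Proof. by elim/quo_ind=> x; rewrite quo_addE add0r. Qed.

Fact quo_addN : left_inverse (quo_pi 0) quo_opp quo_add.
Proof. by elim/quo_ind=> x; rewrite quo_oppE quo_addE addNr. Qed.

HB.instance Definition _ :=
  GRing.isZmodule.Build quo quo_addA quo_addC quo_add0 quo_addN.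

Fact quo_scaleA a b (x : quo) :
  quo_scale a (quo_scale b x) = quo_scale (a * b) x.
Proof. by elim/quo_ind: x => x; rewrite !quo_scaleE scalerA. Qed.

Fact quo_scale1 : left_id 1 quo_scale.
Proof. by elim/quo_ind=> x; rewrite quo_scaleE scale1r. Qed.

Fact quo_scaleDr : right_distributive quo_scale +%R.
Proof.
move=> a; elim/quo_ind=> x; elim/quo_ind=> y.
by rewrite /+%R /= !(quo_scaleE, quo_addE) scalerDr.
Qed.

Fact quo_scaleDl x : {morph (fun a => quo_scale a x) : a b / a + b}.
Proof.
elim/quo_ind: x => x a b.
by rewrite [in RHS]/+%R /= !(quo_scaleE, quo_addE) scalerDl.
Qed.

HB.instance Definition _ := GRing.Zmodule_isLmodule.Build A quo
  quo_scaleA quo_scale1 quo_scaleDr quo_scaleDl.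

End Quotient.

Section Constructions.
Variable A : pzRingType.
Implicit Types (U V W M N C X : lmodType A).

Lemma quotient_ex V (S : V -> Prop) : smod S ->
  exists (C : lmodType A) (p : {linear V -> C}),
    onto p /\ forall v, p v = 0 <-> S v.
Proof.
move=> hS; have [|p pE] := @linear_of_fun A V (quotient hS) (@quo_pi _ _ _ hS).
  move=> a u v.
  by rewrite /+%R /= /GRing.scale /= quo_scaleE quo_addE.
exists (quotient hS), p; split.
  by move=> w; exists (val w); rewrite pE quo_piK.
move=> v; rewrite pE.
have -> : S v = S (v - 0) by rewrite subr0.
exact: quo_piP.
Qed.

Lemma smod_image M N (i : {linear M -> N}) :
  smod (fun n => exists m, i m = n).
Proof.
split; first by exists 0; rewrite linear0.
by move=> a _ _ [u <-] [v <-]; exists (a *: u + v); rewrite linearP.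
Qed.

Lemma smod_ker M N (p : {linear M -> N}) : smod (fun m => p m = 0).
Proof.
split; first by rewrite linear0.
by move=> a u v pu pv; rewrite linearP pu pv scaler0 addr0.
Qed.

Lemma coker_ex M N (i : {linear M -> N}) : injective i ->
  exists (C : lmodType A) (p : {linear N -> C}), ses i p.
Proof.
move=> ii; have [C [p [ps pE]]] := quotient_ex (smod_image i).
by exists C, p; split.
Qed.

Lemma ker_ex N C (p : {linear N -> C}) : onto p ->
  exists (M : lmodType A) (i : {linear M -> N}), ses i p.
Proof.
move=> ps; have [M [i [ii iE]]] := submodule_ex (smod_ker p).
by exists M, i; split.
Qed.

Lemma zero_module_ex : exists Z : lmodType A, forall z : Z, z = 0.
Proof.
have h : smod (fun _ : A^o => True) by [].
have [Z [p [ps pE]]] := quotient_ex h.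
by exists Z => z; have [v <-] := ps z; apply/pE.
Qed.

End Constructions.

(** * Projective modules and extension of linear maps *)

Section Projective.
Variable A : pzRingType.
Implicit Types (U V W M N C X P F E : lmodType A).

(** Projectivity takes the form of the dual basis lemma because the coordinates [c i] are used
    directly, both to solve linear systems and to measure elements by powers of the radical. *)
Definition dual_basis P (I : choiceType) (b : I -> P)
    (c : I -> {linear P -> A^o}) :=
  forall w, exists s : seq I, [/\ uniq s, forall i, i \notin s -> c i w = 0 &
    w = \sum_(i <- s) (c i w : A) *: b i].

Definition projective P :=
  exists (I : choiceType) (b : I -> P) (c : I -> {linear P -> A^o}),
    dual_basis b c.

Lemma big_supp (I : eqType) V (s s' : seq I) (f : I -> V) :
  uniq s -> uniq s' -> {subset s <= s'} -> (forall i, i \notin s -> f i = 0) ->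
  \sum_(i <- s') f i = \sum_(i <- s) f i.
Proof.
move=> us us' ss' f0; rewrite (bigID (fun i => i \in s)) /=.
rewrite [X in _ + X]big1 ?addr0 => [|i /f0 //].
rewrite -big_filter; apply: perm_big; apply: uniq_perm => //.
  exact: filter_uniq.
by move=> i; rewrite mem_filter andb_idr // => /ss'.
Qed.

Lemma dual_basis_sub P (I : choiceType) (c : I -> {linear P -> A^o}) (w : P)
    V (g : I -> V) (s s' : seq I) :
  uniq s -> (forall i, i \notin s -> c i w = 0) ->
  uniq s' -> (forall i, i \notin s' -> c i w = 0) ->
  \sum_(i <- s) (c i w : A) *: g i = \sum_(i <- s') (c i w : A) *: g i.
Proof.
move=> us c0 us' c0'.
have z t : (forall i, i \notin t -> c i w = 0) ->
    forall i, i \notin t -> (c i w : A) *: g i = 0.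
  by move=> h i /h ->; rewrite scale0r.
rewrite -(@big_supp _ _ s (undup (s ++ s'))) ?undup_uniq //; first last.
- exact: z.
- by move=> i ii; rewrite mem_undup mem_cat ii.
rewrite -(@big_supp _ _ s' (undup (s ++ s'))) ?undup_uniq //; first last.
- exact: z.
- by move=> i ii; rewrite mem_undup mem_cat ii orbT.
Qed.

Lemma dual_basis_lift P (I : choiceType) (b : I -> P)
    (c : I -> {linear P -> A^o}) (N : lmodType A) (g : I -> N) :
  dual_basis b c ->
  exists f : {linear P -> N},
    forall w s, uniq s -> (forall i, i \notin s -> c i w = 0) ->
      f w = \sum_(i <- s) (c i w : A) *: g i.
Proof.
move=> bc.
pose G (w : P) (v : N) := exists s : seq I,
  [/\ uniq s, forall i, i \notin s -> c i w = 0 &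
      v = \sum_(i <- s) (c i w : A) *: g i].
have Gu w v v' : G w v -> G w v' -> v = v'.
  move=> [s [us c0 ->]] [s' [us' c0' ->]].
  exact: dual_basis_sub.
have [|||f fG] := @linear_of_rel A P N G.
- by move=> w; have [s [us c0 _]] := bc w; eexists; exists s; split.
- move=> a v w v' w' [s [us c0 ->]] [s' [us' c0' ->]].
  have sub i : i \notin undup (s ++ s') -> c i v = 0 /\ c i v' = 0.
    rewrite mem_undup mem_cat => /norP [ns ns'].
    by rewrite (c0 _ ns) (c0' _ ns').
  exists (undup (s ++ s')); split; first exact: undup_uniq.
    by move=> i /sub [e e']; rewrite linearP e e' scaler0 addr0.
  rewrite (@dual_basis_sub P I c v N g s (undup (s ++ s'))) ?undup_uniq //;
    last by move=> i /sub [].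
  rewrite (@dual_basis_sub P I c v' N g s' (undup (s ++ s'))) ?undup_uniq //;
    last by move=> i /sub [].
  rewrite scaler_sumr -big_split /=; apply: eq_bigr => i _.
  by rewrite linearP scalerDl scalerA.
- move=> w [s [us c0 ->]]; rewrite big1 // => i _.
  by rewrite linear0 scale0r.
exists f => w s us c0; apply: (Gu w); first exact: fG.
by exists s; split.
Qed.

Lemma projective_lift P N C (p : {linear N -> C}) (f : {linear P -> C}) :
  projective P -> onto p -> exists g : {linear P -> N}, forall x, p (g x) = f x.
Proof.
move=> [I [b [c bc]]] ps; have /choice [n pn] := fun i => ps (f (b i)).
have [g gP] := @dual_basis_lift P I b c N n bc.
exists g => x; have [s [us c0 xE]] := bc x.
rewrite (gP _ s) // [in RHS]xE !linear_sum; apply: eq_bigr => i _.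
by rewrite !linearZ /= pn.
Qed.

Lemma projective_retract P F (s : {linear P -> F}) (p : {linear F -> P}) :
  (forall x, p (s x) = x) -> projective F -> projective P.
Proof.
move=> ps [I [b [c bc]]].
exists I, (fun i => p (b i)), (fun i => c i \o s) => w.
have [l [ul c0 e]] := bc (s w); exists l; split=> //.
rewrite -{1}[w]ps {1}e linear_sum; apply: eq_bigr => i _.
by rewrite linearZ.
Qed.

Lemma free_cover_ex X :
  exists (F K : lmodType A) (i : {linear K -> F}) (p : {linear F -> X}),
    projective F /\ ses i p.
Proof.
(* [F] will be the free module on the underlying set of [X]: finitely supported functions, with the
   indicator functions [d x] as basis. *)
pose S (f : X -> A^o) :=
  exists s : seq X, uniq s /\ forall i, i \notin s -> f i = 0.
have hS : smod S.
  split; first by exists [::].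
  move=> a u v [s [us u0]] [s' [us' v0]].
  exists (undup (s ++ s')); split; first exact: undup_uniq.
  move=> i; rewrite mem_undup mem_cat => /norP [ns ns'].
  by rewrite /+%R /= /GRing.scale /= (u0 _ ns) (v0 _ ns') scaler0 addr0.
have [F [j [ij jS]]] := submodule_ex hS.
have /choice [c cP] : forall x : X, exists c : {linear F -> A^o},
    forall w, c w = j w x.
  move=> x; apply: linear_of_fun => a u v.
  by rewrite linearP.
pose d (x : X) : X -> A^o := fun y => (x == y)%:R.
have /choice [b bP] : forall x : X, exists b : F, j b = d x.
  move=> x; apply/jS; exists [:: x]; split=> // y.
  by rewrite inE eq_sym /d => /negbTE ->.
have bc : dual_basis b c.
  move=> w; have /jS [s [us w0]] : exists m, j m = j w by exists w.
  exists s; split=> //; first by move=> i /w0; rewrite cP.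
  apply: ij; rewrite linear_sum; apply/funext => x.
  rewrite fct_sumE.
  under eq_bigr => i _ do rewrite linearZ /= bP cP /GRing.scale /=.
  have [xs|xs] := boolP (x \in s).
    rewrite (bigD1_seq x) //= /d eqxx big1 ?addr0 => [|y /negbTE ->].
      by rewrite /GRing.scale /= mulr1.
    by rewrite scaler0.
  rewrite w0 // big1_seq // => y /andP [_ ys]; rewrite /d.
  by case: eqP => [e|_]; [rewrite -e ys in xs | rewrite scaler0].
have [p pP] := @dual_basis_lift F X b c X id bc.
have ps : onto p.
  move=> x; exists (b x); rewrite (pP _ [:: x]) //.
    by rewrite big_seq1 cP bP /d eqxx scale1r.
  by move=> y; rewrite inE eq_sym cP bP /d => /negbTE ->.
have [K [i ip]] := ker_ex ps.
by exists F, K, i, p; split=> //; exists X, b, c.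
Qed.

End Projective.

(** * Extension of partial linear maps and Baer's criterion *)

Section Extension.
Variable A : pzRingType.
Implicit Types (U V W M N C X P F E : lmodType A).

Definition lin_rel F E (G : F -> E -> Prop) :=
  G 0 0 /\ forall a x e y e', G x e -> G y e' -> G (a *: x + y) (a *: e + e').

Definition functional_rel F E (G : F -> E -> Prop) := forall e, G 0 e -> e = 0.

(** Zorn's lemma on graphs. The last hypothesis lets the domain grow by one element [x]: on the
    ideal of all [a] with [a *: x] in the domain, the map is multiplication into some [m], which
    becomes the value at [x]. Baer's condition and semisimplicity of A/J are two ways to meet it. *)
Lemma lin_rel_extend F E (G0 : F -> E -> Prop) :
  lin_rel G0 -> functional_rel G0 ->
  (forall G : F -> E -> Prop, (forall x e, G0 x e -> G x e) ->
    lin_rel G -> functional_rel G ->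
    forall x, exists m, forall a e, G (a *: x) e -> e = a *: m) ->
  exists f : {linear F -> E}, forall x e, G0 x e -> f x = e.
Proof.
move=> lG0 fG0 step.
(* [G0] is adjoined to every member because the empty chain has an empty union, which must still be
   good. *)
pose T := (F * E)%type; pose R (X : set T) x e := G0 x e \/ X (x, e).
pose good (X : set T) := lin_rel (R X) /\ functional_rel (R X).
have [|X [[lX fX] maxX]] := @Zorn_bigcup T good.
  move=> Fam Fgood tot.
  have amb x e y e' : R (\bigcup_(X in Fam) X)%classic x e ->
      R (\bigcup_(X in Fam) X)%classic y e' ->
      exists Z, [/\ good Z, R Z x e, R Z y e' &
        forall z f, R Z z f -> R (\bigcup_(X in Fam) X)%classic z f].
    have up Z : Fam Z ->
        forall z f, R Z z f -> R (\bigcup_(X in Fam) X)%classic z f.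
      by move=> FZ z f [?|Zz]; [left | right; exists Z].
    move=> [Gx|[X FX Xx]] [Gy|[Y FY Yy]].
    - exists set0; split; [|by left|by left|by move=> z f [?|[]]; left].
      have E0 z f : R set0 z f -> G0 z f by case.
      split.
        case: lG0 => G00 Gl; split; first by left.
        by move=> a u g v g' /E0 h /E0 h'; left; apply: Gl.
      by move=> f /E0 /fG0.
    - by exists Y; split; [exact: Fgood|left|right|exact: up].
    - by exists X; split; [exact: Fgood|right|left|exact: up].
    have [XY|YX] := tot _ _ FX FY.
      by exists Y; split; [exact: Fgood|right; exact: XY|right|exact: up].
    by exists X; split; [exact: Fgood|right|right; exact: YX|exact: up].
  split; first split.
  - by left; case: lG0.
  - move=> a x e y e' h h'; have [Z [[[_ lZ] _] hx hy up]] := amb _ _ _ _ h h'.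
    by apply: up; apply: lZ.
  - by move=> e h; have [Z [[_ fZ] hx _ _]] := amb _ _ _ _ h h; apply: fZ.
have tot x : exists e, R X x e.
  have [m mP] := step _ (fun x e h => or_introl h) lX fX x.
  apply: contrapT => nx.
  pose Y : set T := fun z => exists a y e, R X y e /\
    z = (y + a *: x, e + a *: m).
  have RY z e : R Y z e <-> exists a y f, R X y f /\
      (z, e) = (y + a *: x, f + a *: m).
    split; last by right.
    case=> // Gz; exists 0, z, e; split; first by left.
    by rewrite !scale0r !addr0.
  apply: (maxX Y).
    split; last first.
      move=> sub; apply: nx; exists m; right; apply: sub.
      exists 1, 0, 0; split; first by case: lX.
      by rewrite !scale1r !add0r.
    move=> [y e] Xy; exists 0, y, e; split; first by right.
    by rewrite !scale0r !addr0.
  split; first split.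
  - by left; case: lG0.
  - move=> a u e v e' /RY [b [y [f [h [-> ->]]]]].
    move=> /RY [b' [y' [f' [h' [-> ->]]]]].
    apply/RY; exists (a * b + b'), (a *: y + y'), (a *: f + f'); split.
      by case: lX => _; apply.
    by rewrite !scalerDr !scalerDl !scalerA; congr (_, _); rewrite addrACA.
  - move=> e /RY [a [y [f [h [e0 ->]]]]].
    have yE : y = (- a) *: x.
      by rewrite scaleNr; apply/eqP; rewrite -addr_eq0 -e0.
    by rewrite (mP (- a) f) -?yE // scaleNr addNr.
have [|f fP] := @linear_of_rel A F E (R X) tot _ fX.
  by move=> a v w v' w' h h'; case: lX => _; apply.
exists f => x e h.
have := proj2 lX (-1) _ _ _ _ (fP x) (or_introl h : R X x e).
by rewrite !scaleN1r addNr => /fX /eqP; rewrite addrC subr_eq0 => /eqP ->.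
Qed.

Definition baer_condition E :=
  forall L : A -> E -> Prop, @lin_rel A^o E L -> @functional_rel A^o E L ->
    exists m, forall a e, L a e -> e = a *: m.

Lemma baer_extend F E (G0 : F -> E -> Prop) :
  baer_condition E -> lin_rel G0 -> functional_rel G0 ->
  exists f : {linear F -> E}, forall x e, G0 x e -> f x = e.
Proof.
move=> hE lG0 fG0; apply: lin_rel_extend => // G G0G [Gz lG] fG x.
have [||m mP] := hE (fun a e => G (a *: x) e).
- split; first by rewrite scale0r.
  move=> a u e v e' h h'; rewrite scalerDl.
  by have := lG a _ _ _ _ h h'; rewrite scalerA.
- by move=> e; rewrite scale0r; apply: fG.
- by exists m.
Qed.

Lemma baer E : baer_condition E -> injective_module E.
Proof.
move=> hE M N f g fi.
have [//|||h hP] := @baer_extend N E (fun n e => exists m, f m = n /\ g m = e).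
- split; first by exists 0; rewrite !linear0.
  move=> a _ _ _ _ [m [<- <-]] [m' [<- <-]].
  by exists (a *: m + m'); rewrite !linearP.
- move=> e [m [fm <-]]; rewrite -(linear0 g); congr (g _).
  by apply: fi; rewrite fm linear0.
by exists h => x; apply: hP; exists x.
Qed.

Lemma inj_extend F E (G0 : F -> E -> Prop) :
  injective_module E -> lin_rel G0 -> functional_rel G0 ->
  exists f : {linear F -> E}, forall x e, G0 x e -> f x = e.
Proof.
move=> hE [G00 lG0] fG0.
have [|M [i [ii iS]]] := @submodule_ex A F (fun x => exists e, G0 x e).
  split; first by exists 0.
  by move=> a u v [e he] [e' he']; exists (a *: e + e'); apply: lG0.
have [|||g gP] := @linear_of_rel A M E (fun m e => G0 (i m) e).
- by move=> m; apply/iS; exists m.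
- by move=> a v w v' w' h h'; rewrite linearP; apply: lG0.
- by move=> w; rewrite linear0; apply: fG0.
have [f fP] := hE _ _ i g ii.
exists f => x e h; have [|m im] := proj1 (iS x); first by exists e.
rewrite -im fP; move: h; rewrite -im => h.
have := lG0 (-1) _ _ _ _ (gP m) h.
by rewrite !scaleN1r addNr => /fG0 /eqP; rewrite addrC subr_eq0 => /eqP ->.
Qed.

End Extension.

(** * Enough injectives *)

Section InjectiveBasics.
Variable A : pzRingType.
Implicit Types (U V W M N C X P F E : lmodType A).

Lemma injective_fct (X : Type) E :
  injective_module E -> injective_module (X -> E).
Proof.
move=> hE M N f g fi.
have /choice [h hP] : forall x : X, exists h : {linear N -> E},
    forall m, h (f m) = g m x.
  move=> x; have [gx gxE] := @linear_of_fun A M E (fun m => g m x)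
    (fun a u v => congr1 (fun k => k x) (linearP g a u v)).
  by have [h hP] := hE _ _ f gx fi; exists h => m; rewrite hP gxE.
have [|k kE] := @linear_of_fun A N (X -> E) (fun n x => h x n).
  by move=> a u v; apply/funext => x; rewrite linearP.
by exists k => m; rewrite kE; apply/funext => x; rewrite hP.
Qed.

Lemma injective_prod E E' :
  injective_module E -> injective_module E' -> injective_module (E * E')%type.
Proof.
move=> hE hE' M N f g fi.
have [g1 g1E] := @linear_of_fun A M E (fun m => (g m).1)
    (fun a u v => congr1 fst (linearP g a u v)).
have [g2 g2E] := @linear_of_fun A M E' (fun m => (g m).2)
    (fun a u v => congr1 snd (linearP g a u v)).
have [h1 h1E] := hE _ _ f g1 fi; have [h2 h2E] := hE' _ _ f g2 fi.
have [|h hP] := @linear_of_fun A N (E * E')%type (fun n => (h1 n, h2 n)).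
  by move=> a u v; rewrite !linearP.
by exists h => m; rewrite hP h1E h2E g1E g2E -surjective_pairing.
Qed.

End InjectiveBasics.

(** * The abelian group Q/Z *)

Section RationalsModZ.

Lemma int_ideal (L : int -> Prop) : @smod int int^o L ->
  exists d, L d /\ forall a, L a -> exists q, a = q * d.
Proof.
move=> hL.
have absL (a : int) : L a -> L (`|a|%N%:Z).
  move=> La; rewrite abszE; case: (ger0P a) => // _.
  exact: (smodN hL La).
have [[a [La a0]]|no] := pselect (exists a, L a /\ a <> 0).
  have ex : exists n, (0 < n)%N && `[< L n%:Z >].
    exists `|a|%N; rewrite absz_gt0; apply/andP; split; first exact/eqP.
    exact/asboolP/absL.
  case: (ex_minnP ex) => n /andP [n0 /asboolP Ln] min.
  exists n%:Z; split=> // b Lb; exists (b %/ n%:Z)%Z.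
  have Lr : L (b %% n%:Z)%Z.
    rewrite /modz; apply: (smodB hL) => //.
    exact: (smodZ hL (b %/ n%:Z)%Z Ln).
  have r0 : (0 <= b %% n%:Z)%Z by apply: modz_ge0; lia.
  have rn : (b %% n%:Z < n%:Z)%Z by rewrite ltz_pmod.
  rewrite {1}(divz_eq b n%:Z).
  have [->|rn0] := eqVneq (b %% n%:Z)%Z 0; first by rewrite addr0.
  have := min `|(b %% n%:Z)%Z|%N; rewrite absz_gt0 rn0 => /(_ _).
  move=> h; have : (n <= `|(b %% n%:Z)%Z|)%N by apply: h; apply/asboolP/absL.
  by lia.
exists 0; split; first exact: smod0 hL.
move=> a La; exists 0; apply: contrapT => a0; apply: no; exists a; split=> //.
Qed.

Definition int_in_rat (x : zmodule rat) := exists k : int, x = k%:~R :> rat.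

Lemma smod_int_in_rat : smod int_in_rat.
Proof.
split; first by exists 0.
move=> a u v [k ->] [l ->]; exists (a * k + l).
by rewrite rmorphD rmorphM /= scalezrE mulrzl.
Qed.

(** [T] is Q/Z. Divisibility gives Baer's condition, as ideals of the integers are principal. If the
    annihilator of [x] is generated by [d], the separating map sends [x] to the class of 1/d, or of
    1/2 when d = 0. *)
Lemma rat_mod_int_ex : exists T : lmodType int,
  baer_condition T /\
  forall (M : lmodType int) (x : M), x <> 0 ->
    exists f : {linear M -> T}, f x <> 0.
Proof.
have [T [p [ps pS]]] := quotient_ex smod_int_in_rat.
have hT : baer_condition T.
  move=> L lL fL.
  have [|d [[e Lde] dP]] := @int_ideal (fun a => exists e, L a e).
    case: lL => L0 lL; split; first by exists 0.
    by move=> a u v [e he] [e' he']; exists (a *: e + e'); apply: lL.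
  have uL a e1 e2 : L a e1 -> L a e2 -> e1 = e2.
    move=> h1 h2; have := (proj2 lL) (-1) _ _ _ _ h1 h2.
    rewrite !scaleN1r addNr => /fL /eqP.
    by rewrite addrC subr_eq0 => /eqP ->.
  have [m dm] : exists m, d *: m = e.
    have [d0|d0] := eqVneq d 0.
      by exists 0; rewrite scaler0; apply/esym/fL; rewrite -d0.
    have [q qe] := ps e; exists (p ((q : rat) / d%:~R : rat)).
    rewrite -linearZ -qe; congr (p _); rewrite scalezrE.
    rewrite -mulrzr -mulrA mulVf ?mulr1 //.
    by rewrite intr_eq0.
  exists m => a e' h'; have [|q aE] := dP a; first by exists e'.
  have L00 : L 0 0 by case: lL.
  have := proj2 lL q _ _ _ _ Lde L00; rewrite !addr0 => h.
  rewrite -dm in h; rewrite aE -scalerA.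
  by apply: (uL a) => //; rewrite aE.
exists T; split=> // M x x0.
have [|d [dx dP]] := @int_ideal (fun a => a *: x = 0).
  split; first by rewrite scale0r.
  by move=> a u v u0 v0; rewrite scalerDl -scalerA u0 v0 scaler0 addr0.
have [t [t0 dt]] : exists t : T, t <> 0 /\ d *: t = 0.
  have [->|d0] := eqVneq d 0.
    exists (p (2%:R^-1 : rat)); split; last by rewrite scale0r.
    move/pS => [k] e.
    have : (2 * k)%:~R = 1 :> rat.
      by rewrite rmorphM /= -e divff.
    by move=> /eqP; rewrite -[1]/(1%:~R) eqr_int => /eqP; lia.
  exists (p (d%:~R^-1 : rat)); split.
    move/pS => [k] e; apply: x0; rewrite -[x]scale1r.
    have -> : 1 = k * d.
      apply/eqP; rewrite -(eqr_int rat) rmorphM /= -e mulVf // intr_eq0 //.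
    by rewrite -scalerA dx scaler0.
  rewrite -linearZ; apply/pS; exists 1.
  by rewrite scalezrE -mulrzr mulVf // intr_eq0.
have [||f fP] :=
    @baer_extend _ M T (fun y e => exists a, y = a *: x /\ e = a *: t) hT.
- split; first by exists 0; rewrite !scale0r.
  move=> a _ _ _ _ [b [-> ->]] [b' [-> ->]].
  by exists (a * b + b'); rewrite !scalerDl !scalerA.
- move=> _ [a [/esym /dP [q ->] ->]].
  by rewrite -scalerA dt scaler0.
by exists f; rewrite (fP x t) //; exists 1; rewrite !scale1r.
Qed.

End RationalsModZ.

(** * Coinduced modules *)

Section Coinduced.
Variables (A : pzRingType) (T : lmodType int).

Definition additive_pred : {pred (A -> T)} :=
  fun f => `[< forall x y, f (x + y) = f x + f y >].

Lemma additive_pred_closed : zmod_closed additive_pred.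
Proof.
split; first by apply/asboolP => x y; rewrite /0 /= addr0.
move=> f g /asboolP fa /asboolP ga; apply/asboolP => x y.
by rewrite /+%R /= /-%R /= fa ga opprD addrACA.
Qed.

HB.instance Definition _ :=
  GRing.isZmodClosed.Build (A -> T) additive_pred additive_pred_closed.

(** The module Hom_Z(A, T), with (a f)(b) = f(b a). Evaluation at 1 identifies the linear maps from
    [M] into it with the additive maps from [M] to [T]; this adjunction makes it injective. *)
Definition coind : Type := {f : A -> T | additive_pred f}.
HB.instance Definition _ := SubChoice.on coind.
HB.instance Definition _ := [SubChoice_isSubZmodule of coind by <:].

Lemma coindD (f : coind) x y : val f (x + y) = val f x + val f y.
Proof. by move: x y; apply/asboolP; exact: (valP f). Qed.

Definition mk_coind (f : A -> T) (fa : forall x y, f (x + y) = f x + f y) :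
  coind := exist _ f (introT (asboolP _) fa).

Definition coind_scale (a : A) (f : coind) : coind :=
  @mk_coind (fun b => val f (b * a))
    (fun x y => etrans (congr1 _ (mulrDl x y a)) (coindD f _ _)).

Fact coind_scaleA a b (f : coind) :
  coind_scale a (coind_scale b f) = coind_scale (a * b) f.
Proof. by apply: val_inj; apply/funext => x /=; rewrite mulrA. Qed.

Fact coind_scale1 : left_id 1 coind_scale.
Proof. by move=> f; apply: val_inj; apply/funext => x /=; rewrite mulr1. Qed.

Fact coind_scaleDr : right_distributive coind_scale +%R.
Proof. by move=> a f g; apply: val_inj; apply/funext => x. Qed.

Fact coind_scaleDl (f : coind) :
  {morph (fun a => coind_scale a f) : a b / a + b}.
Proof.
by move=> a b; apply: val_inj; apply/funext => x /=; rewrite mulrDr coindD.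
Qed.

HB.instance Definition _ := GRing.Zmodule_isLmodule.Build A coind
  coind_scaleA coind_scale1 coind_scaleDr coind_scaleDl.

End Coinduced.

Section EnoughInjectives.
Variable A : pzRingType.
Implicit Types (U V W M N C X P F E : lmodType A).

Lemma linear_int (M : zmodType) (T : lmodType int) (f : M -> T) :
  (forall x y, f (x + y) = f x + f y) ->
  exists g : {linear zmodule M -> T}, forall x, g x = f x.
Proof.
move=> fa; apply: linear_of_fun => a u v; rewrite fa; congr (_ + _).
rewrite scalezrE.
have f0 : f 0 = 0 by apply: (addrI (f 0)); rewrite -fa !addr0.
have fN x : f (- x) = - f x.
  by apply: (addrI (f x)); rewrite -fa !subrr.
have fn n : f (u *+ n) = (n%:Z) *: f u.
  elim: n => [|n IH]; first by rewrite scale0r.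
  by rewrite mulrS fa IH intS scalerDl scale1r.
case: a => n; first exact: fn.
by rewrite NegzE mulrNz fN fn scaleNr.
Qed.

Lemma injective_coind (T : lmodType int) :
  baer_condition T -> injective_module (coind A T : lmodType A).
Proof.
move=> hT M N f g fi.
pose E : lmodType A := coind A T.
have [||h hP] := @baer_extend _ (zmodule N) T
  (fun n t => exists m, f m = n /\ val (g m) 1 = t) hT.
- split; first by exists 0; rewrite !linear0.
  move=> a _ _ _ _ [m [<- <-]] [m' [<- <-]].
  have [g1 g1E] := @linear_int M T (fun m => val (g m) 1)
    (fun x y => congr1 (fun k => val k 1) (linearD g x y)).
  have [f1 f1E] := @linear_int M (zmodule N) f (linearD f).
  exists (a *: (m : zmodule M) + m'); split.
    by rewrite -f1E linearP !f1E.
  by rewrite -g1E linearP !g1E.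
- move=> t [m [fm <-]].
  have -> : m = 0 by apply: fi; rewrite fm linear0.
  by rewrite linear0.
pose k (n : N) : E := @mk_coind A T (fun b => h (b *: n))
  (fun x y => etrans (congr1 h (scalerDl n x y)) (linearD h _ _)).
have [|K KE] := @linear_of_fun A N E k.
  move=> a u v; apply: val_inj; apply/funext => b /=.
  by rewrite scalerDr linearD scalerA.
exists K => m; rewrite KE; apply: val_inj; apply/funext => b /=.
rewrite (hP _ (val (g (b *: m)) 1)); first by rewrite linearZ /= mul1r.
by exists (b *: m); rewrite linearZ.
Qed.

(** [M] is evaluated into the power of Hom_Z(A, T) indexed by all linear maps from [M] to it; these
    separate points because Q/Z does. *)
Lemma enough_injectives M :
  exists (E : lmodType A) (i : {linear M -> E}),
    injective_module E /\ injective i.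
Proof.
have [T [hT sep]] := rat_mod_int_ex.
pose E0 : lmodType A := coind A T.
have [|i iE] := @linear_of_fun A M ({linear M -> E0} -> E0) (fun m f => f m).
  by move=> a u v; apply/funext => f; rewrite linearP.
exists ({linear M -> E0} -> E0), i; split.
  exact/injective_fct/injective_coind.
apply: linear_inj0 => m; rewrite iE => m0.
apply: contrapT => /(sep (zmodule M)).
case=> x xm; pose k (n : M) : E0 := @mk_coind A T (fun b => x (b *: n))
  (fun a b => etrans (congr1 x (scalerDl n a b)) (linearD x _ _)).
have [|K KE] := @linear_of_fun A M E0 k.
  move=> a u v; apply: val_inj; apply/funext => b /=.
  by rewrite scalerDr linearD scalerA.
apply: xm; have /(congr1 (fun f => val (f K) 1)) := m0.
by rewrite KE /= scale1r.
Qed.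

Lemma injective_embedding_ex M :
  exists (E C : lmodType A) (i : {linear M -> E}) (p : {linear E -> C}),
    injective_module E /\ ses i p.
Proof.
have [E [i [hE ii]]] := enough_injectives M.
by have [C [p ip]] := coker_ex ii; exists E, C, i, p.
Qed.

End EnoughInjectives.

(** * Vanishing of the first extension group *)

Section Ext.
Variable A : pzRingType.
Implicit Types (U V W M N C X Y Z P F E G H I L : lmodType A).

(** Packaged so that one cover can be chosen for each module; syzygies become a function, which can
    be iterated. *)
Record cover X := Cover {
  cover_free : lmodType A;
  cover_ker : lmodType A;
  cover_in : {linear cover_ker -> cover_free};
  cover_pr : {linear cover_free -> X};
  cover_proj : projective cover_free;
  cover_ses : ses cover_in cover_pr }.

Lemma cover_ex X : exists c : cover X, True.
Proof.
by have [F [K [i [p [hF ip]]]]] := free_cover_ex X; exists (Cover hF ip).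
Qed.

Definition the_cover X := sval (cid (cover_ex X)).
Definition Fr X : lmodType A := cover_free (the_cover X).
Definition Om X : lmodType A := cover_ker (the_cover X).
Definition om_in X : {linear Om X -> Fr X} := cover_in (the_cover X).
Definition fr_pr X : {linear Fr X -> X} := cover_pr (the_cover X).

Lemma Fr_projective X : projective (Fr X).
Proof. exact: cover_proj. Qed.

Lemma Om_ses X : ses (om_in X) (fr_pr X).
Proof. exact: cover_ses. Qed.

(* [Ext^1(X, M) = 0], computed with the chosen free cover of [X]. *)
Definition ext1_zero X M := forall f : {linear Om X -> M},
  exists g : {linear Fr X -> M}, forall k, g (om_in X k) = f k.

(** The free cover lifts to a map [a] into [N], whose restriction to the syzygy lands in [M].
    Extending that restriction to the cover and subtracting it from [a] gives a map that vanishes on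
    the syzygy. *)
Lemma ext1_lift X M N C (i : {linear M -> N}) (p : {linear N -> C})
    (f : {linear X -> C}) :
  ext1_zero X M -> ses i p ->
  exists g : {linear X -> N}, forall x, p (g x) = f x.
Proof.
move=> eXM ip; have [ii pso ex] := ip; have [oi os oex] := Om_ses X.
have [a aP] := projective_lift (f \o fr_pr X) (Fr_projective X) pso.
have [|h hP] := factor_inj (f := a \o om_in X) ii.
  by move=> k; apply/ex; rewrite /= aP /= (ses0 _ (Om_ses X)) linear0.
have [g gP] := eXM h.
have [|b bP] := factor_onto (f := a \- (i \o g)) os.
  by move=> v /oex [k <-] /=; rewrite gP hP subrr.
exists b => x; have [v <-] := os x.
by rewrite bP /= linearB aP /= (ses0 _ ip) subr0.
Qed.

Lemma lift_ext1 X M N C (i : {linear M -> N}) (p : {linear N -> C}) :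
  ses i p -> injective_module N ->
  (forall f : {linear X -> C},
     exists g : {linear X -> N}, forall x, p (g x) = f x) ->
  ext1_zero X M.
Proof.
move=> ip hN lift f; have [ii pso ex] := ip; have [oi os oex] := Om_ses X.
have [a aP] := hN _ _ (om_in X) (i \o f) oi.
have [|b bP] := factor_onto (f := p \o a) os.
  by move=> v /oex [k <-] /=; rewrite aP /= (ses0 _ ip).
have [c cP] := lift b.
have [|g gP] := factor_inj (f := a \- (c \o fr_pr X)) ii.
  by move=> v; apply/ex; rewrite /= linearB cP bP subrr.
exists g => k; apply: ii; rewrite gP /= aP (ses0 _ (Om_ses X)) /=.
by rewrite linear0 subr0.
Qed.

Lemma ext1_injective X E : injective_module E -> ext1_zero X E.
Proof. by move=> hE f; have [oi _ _] := Om_ses X; apply: hE. Qed.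

Lemma ext1_projective P M : projective P -> ext1_zero P M.
Proof.
move=> hP f; have [oi os oex] := Om_ses P.
have [s sP] := projective_lift (idfun : {linear P -> P}) hP os.
have [|r rP] := factor_inj (f := idfun \- (s \o fr_pr P)) oi.
  by move=> v; apply/oex; rewrite /= linearB sP subrr.
exists (f \o r) => k /=; congr (f _); apply: oi.
by rewrite rP /= (ses0 _ (Om_ses P)) linear0 subr0.
Qed.

(* Both sides say that every linear map [Om X -> C] which extends to [Fr X]
   lifts to [I]: an extension can be lifted since [Fr X] is projective, and a
   lift can be extended since [I] is injective. *)
Lemma ext1_shift X M I C (i : {linear M -> I}) (p : {linear I -> C}) :
  ses i p -> injective_module I -> ext1_zero (Om X) M <-> ext1_zero X C.
Proof.
move=> ip hI; have [ii ps ex] := ip; have [oi os oex] := Om_ses X; split.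
  move=> eM f; have [g gP] := ext1_lift f eM ip.
  have [h hP] := hI _ _ (om_in X) g oi.
  by exists (p \o h) => k; rewrite /= hP gP.
move=> eC; apply: (lift_ext1 ip hI) => f; have [g gP] := eC f.
have [h hP] := projective_lift g (Fr_projective X) ps.
by exists (h \o om_in X) => k; rewrite /= hP gP.
Qed.

(** Exactness of Ext^1(X, N) -> Ext^2(X, L) -> Ext^2(X, G), with Ext^2(X, -) read as Ext^1(Om X,
    -). *)
Lemma ext1_dimension_shift X L G N (i : {linear L -> G}) (p : {linear G -> N}) :
  ses i p -> ext1_zero X N -> ext1_zero (Om X) G -> ext1_zero (Om X) L.
Proof.
move=> ip eN eG f; have [ii ps ex] := ip.
have [oi os oex] := Om_ses (Om X).
have [g gP] := eG (i \o f).
have [|h hP] := factor_onto (f := p \o g) os.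
  by move=> v /oex [k <-] /=; rewrite gP /= (ses0 _ ip).
have [a aP] := eN h.
have [b bP] := projective_lift a (Fr_projective X) ps.
have [|k kP] := factor_inj (f := g \- (b \o (om_in X \o fr_pr (Om X)))) ii.
  by move=> v; apply/ex; rewrite /= linearB bP aP hP subrr.
exists k => v; apply: ii; rewrite kP /= gP /= (ses0 _ (Om_ses (Om X))).
by rewrite !linear0 addr0.
Qed.

Lemma ext1_iso X M N (f : {linear M -> N}) :
  injective f -> onto f -> ext1_zero X N -> ext1_zero X M.
Proof.
move=> fi fs eN g; have [h hP] := eN (f \o g).
have [k kP] := factor_inj (f := h) fi (fun v => fs _).
by exists k => v; apply: fi; rewrite kP hP.
Qed.

(* [csyz n M G]: there is an exact sequence
   [0 -> M -> I 0 -> ... -> I n.-1 -> G -> 0] with injective [I i]; for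
   [n = 0] it is an isomorphism [M -> G]. *)
Fixpoint csyz n M G : Prop :=
  if n is n'.+1 then
    exists (I C : lmodType A) (i : {linear M -> I}) (p : {linear I -> C}),
      [/\ injective_module I, ses i p & csyz n' C G]
  else exists f : {linear M -> G}, injective f /\ onto f.

Lemma csyz_ex n M : exists G, csyz n M G.
Proof.
elim: n M => [|n IH] M.
  by exists M, idfun; split=> // x; exists x.
have [I [C [i [p [hI ip]]]]] := injective_embedding_ex M.
by have [G CG] := IH C; exists G, I, C, i, p.
Qed.

Lemma csyz_ext1 n X M G :
  csyz n M G -> ext1_zero (iter n Om X) M <-> ext1_zero X G.
Proof.
elim: n M => [|n IH] M /=.
  move=> [f [fi fs]]; split; last exact: ext1_iso fi fs.
  have [g gP] := factor_inj (f := idfun) fi fs.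
  apply: (@ext1_iso X G M g).
    by move=> x y /(congr1 f); rewrite !gP.
  by move=> m; exists (f m); apply: fi; rewrite gP.
by move=> [I [C [i [p [hI ip /IH <-]]]]]; apply: ext1_shift ip hI.
Qed.

Lemma csyz_snoc n M G I C (i : {linear G -> I}) (p : {linear I -> C}) :
  csyz n M G -> injective_module I -> ses i p -> csyz n.+1 M C.
Proof.
elim: n M => [|n IH] M.
  move=> [f [fi fs]] hI ip; exists I, C, (i \o f), p; split=> //; last first.
    by exists idfun; split=> // x; exists x.
  have [ii ps ex] := ip; split=> //; first exact: inj_comp.
  move=> y; rewrite ex; split=> [[x <-]|[x <-]]; last by exists (f x).
  by have [m <-] := fs x; exists m.
move=> [J [D [j [q [hJ jq DG]]]]] hI ip.
by exists J, D, j, q; split=> //; apply: IH DG hI ip.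
Qed.

(** Here the cosyzygy [H] of [Z] is prescribed and the other two are constructed, because a left
    neighbour of [H] is sought. [Y] embeds into the product by [(h y, j (p y))], where [h] extends
    the embedding [k] of [X]. *)
Lemma csyz_horseshoe n X Y Z (i : {linear X -> Y}) (p : {linear Y -> Z}) H :
  ses i p -> csyz n Z H ->
  exists (G G' : lmodType A) (j : {linear G -> G'}) (q : {linear G' -> H}),
    [/\ csyz n X G, csyz n Y G' & ses j q].
Proof.
elim: n X Y Z i p => [|n IH] X Y Z i p ip.
  move=> [f [fi fs]]; exists X, Y, i, (f \o p); split.
  - by exists idfun; split=> // x; exists x.
  - by exists idfun; split=> // x; exists x.
  - have [ii ps ex] := ip; split=> //.
      by move=> w; have [z <-] := fs w; have [y <-] := ps z; exists y.
    move=> y /=; rewrite -(linear0 f) -ex; split=> [/fi //|->].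
    by [].
move=> [J [C [j [q [hJ jq CH]]]]].
have [I [B [k [r [hI kr]]]]] := injective_embedding_ex X.
have [ii ps ex] := ip; have [ji qs jex] := jq; have [ki rs kex] := kr.
have [h hP] := hI _ _ i k ii.
have [|m mP] := @linear_of_fun A Y (I * J)%type (fun y => (h y, j (p y))).
  by move=> a u v; rewrite !linearP.
have mi : injective m.
  apply: linear_inj0 => y; rewrite mP => -[hy jy].
  have /ex [x xy] : p y = 0 by apply: ji; rewrite linear0.
  rewrite -xy; have -> : x = 0 by apply: ki; rewrite -hP xy hy linear0.
  by rewrite linear0.
have [D [s ms]] := coker_ex mi; have [_ ss mex] := ms.
have [|l lP] := @linear_of_fun A I (I * J)%type (fun y => (y, 0)).
  by move=> a u v; congr (_, _); rewrite /= scaler0 addr0.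
have [|t tP] := @linear_of_fun A (I * J)%type J snd.
  by move=> a u v.
have [|b bP] := factor_onto (f := s \o l) rs.
  move=> v /kex [x <-] /=; apply/mex; exists (i x).
  by rewrite mP lP hP (ses0 _ ip) linear0.
have [|c cP] := factor_onto (f := q \o t) ss.
  by move=> v /mex [y <-] /=; rewrite tP mP (ses0 _ jq).
have bc : ses b c.
  split.
  - apply: linear_inj0 => d; have [v <-] := rs d.
    rewrite bP /= => /mex [y]; rewrite mP lP => -[hy jy].
    have /ex [x xy] : p y = 0 by apply: ji; rewrite linear0.
    by rewrite -hy -xy hP (ses0 _ kr).
  - move=> w; have [v <-] := qs w; exists (s (0, v)).
    by rewrite cP /= tP.
  - move=> d; have [[u v] <-] := ss d; rewrite cP /= tP /=; split.
      move=> /jex [z zv]; have [y yz] := ps z.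
      exists (r (u - h y)); rewrite bP /=; apply/eqP; rewrite -subr_eq0.
      rewrite -linearB; apply/eqP/mex; exists (- y).
      rewrite linearN mP lP yz zv.
      by congr (_, _); rewrite /= ?sub0r // addrAC subrr sub0r.
    move=> [e]; have [w <-] := rs e; rewrite bP /= => e1.
    have : s (l w - (u, v)) = 0 by rewrite linearB e1 subrr.
    move=> /mex [y]; rewrite mP lP => -[_] /= e2.
    apply/jex; exists (- p y); rewrite linearN e2.
    by rewrite sub0r opprK.
have [G [G' [j' [q' [BG DG' e]]]]] := IH _ _ _ _ _ bc CH.
exists G, G', j', q'; split=> //.
- by exists I, B, k, r.
- exists (I * J)%type, D, m, s; split=> //.
  exact: injective_prod.
Qed.

End Ext.

(** * Coresolutions and Gorenstein injective modules *)

Section Coresolutions.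
Variable A : pzRingType.
Implicit Types (U V W M N C X Y Z P F E G H I L : lmodType A).
Implicit Types (Q : lmodType A -> Prop).

Fixpoint cores Q n M : Prop :=
  if n is n'.+1 then
    exists (G L : lmodType A) (i : {linear M -> G}) (p : {linear G -> L}),
      [/\ Q G, ses i p & cores Q n' L]
  else exists (G : lmodType A) (f : {linear M -> G}),
    [/\ Q G, injective f & onto f].

Lemma coresolution_cores Q n M : coresolution Q M n -> cores Q n M.
Proof.
elim: n M => [|n IH] M [G [e [d [QG G0 ei e0 dd]]]].
  exists (G 0%N), e; split=> //; first exact: QG.
  by move=> y; apply/e0; exact: (G0 1%N).
have [C [p ep]] := coker_ex ei; have [_ ps pe] := ep.
exists (G 0%N), C, e, p; split=> //; first exact: QG.
have [|f fP] := factor_onto (f := d 0%N) ps.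
  by move=> v; rewrite pe -e0.
apply: IH; exists (fun i => G i.+1), f, (fun i => d i.+1); split.
- by move=> i ii; apply: QG.
- by move=> i ii; apply: G0.
- apply: linear_inj0 => c; have [v <-] := ps c.
  by rewrite fP => /e0 [x <-]; rewrite (ses0 _ ep).
- move=> y; rewrite dd; split=> [[x <-]|[c <-]]; first by exists (p x).
  by have [v <-] := ps c; exists v.
- by move=> i; apply: dd.
Qed.

Lemma cores_coresolution Q n M : cores Q n M -> coresolution Q M n.
Proof.
elim: n M => [|n IH] M.
  move=> [G [f [QG fi fs]]]; have [Z Z0] := zero_module_ex A.
  exists (fun i => if i is 0%N then G else Z), f, (fun i => \0).
  split=> //; first by case.
  - by case.
  - move=> i y; split=> // _; exists 0.
    by rewrite linear0 (Z0 y).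
move=> [G [L [i [p [QG ip /IH [G' [e [d [QG' G0 ei e0 dd]]]]]]]]].
have [ii ps ex] := ip.
pose G2 k := if k is k'.+1 then G' k' else G.
pose d2 k : {linear G2 k -> G2 k.+1} :=
  if k is k'.+1 return {linear G2 k -> G2 k.+1} then d k' else (e \o p).
exists G2, i, d2; split=> //.
- by case=> [|k] //; exact: QG'.
- by case=> [|k] //; exact: G0.
- move=> y; rewrite -ex /=; split=> [ep0|->]; last exact: linear0.
  by apply: ei; rewrite ep0 linear0.
- case=> [|k] /=; last exact: dd.
  move=> y; rewrite e0; split=> [[x <-]|[x <-]]; last by exists (p x).
  by have [v <-] := ps x; exists v.
Qed.

Lemma cores_injective n M :
  cores (@injective_module A) n M <->
  exists G, csyz n M G /\ injective_module G.
Proof.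
elim: n M => [|n IH] M /=; split.
- by move=> [G [f [hG fi fs]]]; exists G; split=> //; exists f.
- by move=> [G [[f [fi fs]] hG]]; exists G, f.
- move=> [I [C [i [p [hI ip /IH [G [CG hG]]]]]]].
  by exists G; split=> //; exists I, C, i, p.
- move=> [G [[I [C [i [p [hI ip CG]]]]] hG]].
  by exists I, C, i, p; split=> //; apply/IH; exists G.
Qed.

(** [G] is the kernel of [d k], and the image [N] of [d k] is the kernel of [d (1 + k)]. Exactness
    of Hom(E, I) is the case j = 0; shifting along 0 -> G -> I k -> N -> 0 passes from j + 1 for [G]
    to j for [N]. *)
Lemma gorenstein_injective_ext1 G E j :
  gorenstein_injective G -> injective_module E ->
  ext1_zero (iter j (@Om A) E) G.
Proof.
move=> [I [d [hI dd hd [k [u [ui ud]]]]]] hE.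
elim: j k G u ui ud => [|j IH] k G u ui ud.
all: have [N [v [vi vP]]] := submodule_ex (smod_ker (d (1 + k))).
all: have [|p pP] := factor_inj (f := d k) vi.
1, 3: by move=> x; apply/vP/dd; exists x.
all: have up : ses u p.
1, 3: split=> //.
1, 3: move=> n; have /dd [x xn] : d (1 + k) (v n) = 0 by apply/vP; exists n.
1, 2: by exists x; apply: vi; rewrite pP.
1, 2: by move=> y; rewrite -ud -pP; split=> [->|p0];
  [rewrite linear0 | apply: vi; rewrite p0 linear0].
- apply: (lift_ext1 up) => // f.
  have [g gP] : exists g : {linear E -> I k}, forall x, d k (g x) = (v \o f) x.
    by apply/hd => // x /=; apply/vP; exists (f x).
  by exists g => x; apply: vi; rewrite pP gP.
- apply/(ext1_shift (iter j (@Om A) E) up (hI k)).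
  by apply: (IH _ _ v) => // y; rewrite vP.
Qed.

Lemma cores_gorenstein_ext1 n j M E :
  cores (@gorenstein_injective A) n M -> injective_module E ->
  ext1_zero (iter (n + j) (@Om A) E) M.
Proof.
move=> cM hE; elim: n M cM j => [|n IH] M.
  move=> [G [f [hG fi fs]]] j; rewrite add0n.
  apply: (ext1_iso fi fs).
  exact: gorenstein_injective_ext1.
move=> [G [L [i [p [hG ip cL]]]]] j.
rewrite addSn; apply: (ext1_dimension_shift ip); first exact: IH.
exact: (@gorenstein_injective_ext1 G E (n + j).+1).
Qed.

(** Neighbours on both sides splice into a two-sided complex whose kernels stay in the class;
    vanishing of Ext^1(E, -) on these kernels makes Hom(E, -) of the complex exact. *)
Lemma gorenstein_injective_class (Q : lmodType A -> Prop) :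
  (forall G, Q G -> exists (G' I : lmodType A) (i : {linear G' -> I})
     (p : {linear I -> G}), [/\ Q G', injective_module I & ses i p]) ->
  (forall G, Q G -> exists (G' I : lmodType A) (i : {linear G -> I})
     (p : {linear I -> G'}), [/\ Q G', injective_module I & ses i p]) ->
  (forall G E, Q G -> injective_module E -> ext1_zero E G) ->
  forall G, Q G -> gorenstein_injective G.
Proof.
move=> h1 h2 h3 G QG.
pose S := {H : lmodType A | Q H}.
have /choice [l lP] : forall H : S, exists H' : S,
    exists (I : lmodType A) (i : {linear sval H' -> I})
      (p : {linear I -> sval H}), injective_module I /\ ses i p.
  move=> [H QH]; have [H' [I [i [p [QH' hI ip]]]]] := h1 H QH.
  by exists (exist _ H' QH'), I, i, p.
have /choice [r rP] : forall H : S, exists H' : S,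
    exists (I : lmodType A) (i : {linear sval H -> I})
      (p : {linear I -> sval H'}), injective_module I /\ ses i p.
  move=> [H QH]; have [H' [I [i [p [QH' hI ip]]]]] := h2 H QH.
  by exists (exist _ H' QH'), I, i, p.
pose g : S := exist _ G QG.
(* The kernel in degree [k]: iterated right neighbours of [G] for k >= 0, left ones for k < 0.
   [Negz n] is -(n + 1), hence [n.+1] steps. *)
pose Z (k : int) : S := match k with
  | Posz n => iter n r g | Negz n => iter n.+1 l g end.
pose data k := {I : lmodType A &
  ({linear sval (Z k) -> I} * {linear I -> sval (Z (1 + k)%R)})%type}.
have dataP k : exists s : data k, injective_module (projT1 s) /\
    ses (projT2 s).1 (projT2 s).2.
  suff [k' [k'E [I [i [p [hI ip]]]]]] : exists k', k' = 1 + k /\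
      exists (I : lmodType A) (i : {linear sval (Z k) -> I})
        (p : {linear I -> sval (Z k')}), injective_module I /\ ses i p.
    move: p ip; rewrite {}k'E => p ip.
    by exists (existT _ I (i, p)).
  case: k => n; first by exists (Posz n.+1); split; [lia | exact: rP].
  case: n => [|n]; first by exists (Posz 0); split; [lia | exact: lP].
  by exists (Negz n); split; [lia | exact: (lP (iter n.+1 l g))].
pose s k := sval (cid (dataP k)).
have hs k : injective_module (projT1 (s k)) := proj1 (svalP (cid (dataP k))).
have ss k : ses (projT2 (s k)).1 (projT2 (s k)).2 :=
  proj2 (svalP (cid (dataP k))).
exists (fun k => projT1 (s k)).
exists (fun k => (projT2 (s (1 + k))).1 \o (projT2 (s k)).2).
split=> //.
- move=> k y /=; have [_ p0 _] := ss k; have [i1 p1 e1] := ss (1 + k).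
  have [i2 _ _] := ss (1 + (1 + k)).
  split=> [h|[x <-]]; last by rewrite (ses0 _ (ss (1 + k))) linear0.
  have /e1 [z <-] : (projT2 (s (1 + k))).2 y = 0.
    by apply: i2; rewrite h linear0.
  by have [x <-] := p0 z; exists x.
- move=> E hE k h /=; have [_ p0 e0] := ss k; have [i1 p1 e1] := ss (1 + k).
  have [i2 _ _] := ss (1 + (1 + k)).
  split=> [h0|[f fP] x]; last first.
    by rewrite -fP (ses0 _ (ss (1 + k))) linear0.
  have [|f fP] := factor_inj (f := h) i1.
    by move=> v; apply/e1; apply: i2; rewrite h0 linear0.
  have [|f' f'P] := ext1_lift f _ (ss k).
    by apply: h3 hE; exact: (svalP (Z k)).
  by exists f' => x; rewrite f'P fP.
- exists 0, (projT2 (s 0)).1.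
  have [i0 p0 e0] := ss 0; have [i1 _ _] := ss (1 + 0).
  split=> // y /=; rewrite -e0; split=> [h|->]; last exact: linear0.
  by apply: i1; rewrite h linear0.
Qed.

Lemma injective_gorenstein E : injective_module E -> gorenstein_injective E.
Proof.
have [Z Z0] := zero_module_ex A.
have hZ : injective_module Z.
  by move=> M N f g fi; exists \0 => x; rewrite (Z0 (g x)).
apply: gorenstein_injective_class => [G hG|G hG|G H hG _].
- exists Z, G, \0, idfun; split=> //; split=> [x y _|w|y].
  + by rewrite (Z0 x) (Z0 y).
  + by exists w.
  + by split=> [/= ->|[x <-]] //; exists 0.
- exists Z, G, idfun, \0; split=> //; split=> // [w|y].
  + by exists 0; rewrite (Z0 w).
  + by split=> // _; exists y.
- exact: ext1_injective.
Qed.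

(* The kernels to the left of [G] in a complete resolution are cosyzygies of
   the syzygies of [M]: the horseshoe lemma applied to
   [0 -> Om M -> Fr M -> M -> 0] yields [0 -> G' -> H -> G -> 0], where [H] is
   an [n]-th cosyzygy of a free module. *)
Lemma csyz_gorenstein n :
  (forall X G, csyz n (Fr X) G -> injective_module G) ->
  (forall E, injective_module E -> projective (iter n (@Om A) E)) ->
  forall M G, csyz n M G -> gorenstein_injective G.
Proof.
move=> hF hE M G MG.
apply: (@gorenstein_injective_class (fun G => exists M, csyz n M G)).
- move=> H [N NH].
  have [H' [I [j [q [h1 h2 jq]]]]] := csyz_horseshoe (Om_ses N) NH.
  by exists H', I, j, q; split=> //; [exists (Om N) | apply: hF h2].
- move=> H [N NH]; have [I [C [i [p [hI ip]]]]] := injective_embedding_ex H.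
  exists C, I, i, p; split=> //.
  (* An [n.+1]-st cosyzygy of [N] is an [n]-th cosyzygy of the first one, [D], so [C] stays in the
     class. *)
  by have [J [D [j [q [_ _ DC]]]]] := csyz_snoc NH hI ip; exists D.
- move=> H E [N NH] hEE.
  exact/(csyz_ext1 E NH)/ext1_projective/hE.
- by exists M.
Qed.

Lemma csyz_cores_gorenstein n M G :
  csyz n M G -> gorenstein_injective G -> cores (@gorenstein_injective A) n M.
Proof.
elim: n M => [|n IH] M; first by move=> [f [fi fs]] hG; exists G, f.
move=> [I [C [i [p [hI ip CG]]]]] hG; exists I, C, i, p; split=> //.
  exact: injective_gorenstein.
exact: IH.
Qed.

End Coresolutions.

(** * Finitely generated free resolutions of cyclic modules *)

Section Matrices.
Variable A : pzRingType.
Implicit Types (U V W M N C X Y Z P F E G L : lmodType A).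

Definition lap (I J : finType) (D : I -> J -> A) V (e : J -> V) (i : I) : V :=
  \sum_j D i j *: e j.

Definition rowm (I J : finType) (r : I -> A) (D : I -> J -> A) (j : J) : A :=
  \sum_i r i * D i j.

Definition unit_row (I : finType) (i j : I) : A := (i == j)%:R.

(** The form that exactness takes when Hom(-, V) is applied to a complex of finite free modules with
    matrices [P] and [Q]; the opposite inclusion follows from [comp0]. *)
Definition exact_lap (I J K : finType) (P : J -> I -> A) (Q : K -> J -> A) V :=
  forall v : J -> V, (forall k, lap Q v k = 0) ->
    exists w : I -> V, forall j, v j = lap P w j.

Definition comp0 (I J K : finType) (P : J -> I -> A) (Q : K -> J -> A) :=
  forall k i, \sum_j Q k j * P j i = 0.

Lemma lap_linear (I J : finType) (D : I -> J -> A) V W (f : {linear V -> W})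
  (e : J -> V) i : f (lap D e i) = lap D (fun j => f (e j)) i.
Proof. by rewrite linear_sum; apply: eq_bigr => j _; rewrite linearZ. Qed.

Lemma eq_lap (I J : finType) (D : I -> J -> A) V (e e' : J -> V) i :
  (forall j, e j = e' j) -> lap D e i = lap D e' i.
Proof. by move=> ee; apply: eq_bigr => j _; rewrite ee. Qed.

Lemma lapB (I J : finType) (D : I -> J -> A) V (e e' : J -> V) i :
  lap D (fun j => e j - e' j) i = lap D e i - lap D e' i.
Proof. by rewrite -sumrB; apply: eq_bigr => j _; rewrite scalerBr. Qed.

Lemma rowm0 (I J : finType) (D : I -> J -> A) j : rowm (fun=> 0) D j = 0.
Proof. by rewrite /rowm big1 // => i _; rewrite mul0r. Qed.

Lemma rowm_linear (I J : finType) (D : I -> J -> A) a (r r' : I -> A) j :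
  rowm (fun i => a * r i + r' i) D j = a * rowm r D j + rowm r' D j.
Proof.
rewrite mulr_sumr -big_split; apply: eq_bigr => i _ /=.
by rewrite mulrDl mulrA.
Qed.

Lemma rowm_lap (I J : finType) (r : I -> A) (D : I -> J -> A) V (e : J -> V) :
  \sum_i r i *: lap D e i = \sum_j rowm r D j *: e j.
Proof.
under eq_bigr => i _ do rewrite scaler_sumr.
rewrite exchange_big /=; apply: eq_bigr => j _; rewrite scaler_suml.
by apply: eq_bigr => i _; rewrite scalerA.
Qed.

Lemma lap_comp0 (I J K : finType) (P : J -> I -> A) (Q : K -> J -> A) V
  (w : I -> V) k : comp0 P Q -> lap Q (lap P w) k = 0.
Proof.
by move=> h; rewrite /lap rowm_lap big1 // => i _; rewrite /rowm h scale0r.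
Qed.

Lemma sum_unit_row (I : finType) (i : I) V (e : I -> V) :
  \sum_j unit_row i j *: e j = e i.
Proof.
rewrite (bigD1 i) //= /unit_row eqxx scale1r big1 ?addr0 // => j.
by rewrite eq_sym => /negbTE ->; rewrite scale0r.
Qed.

Lemma rowm_unit_row (I J : finType) (D : I -> J -> A) i j :
  rowm (unit_row i) D j = D i j.
Proof. exact: (@sum_unit_row I i A^o (fun i => D i j)). Qed.

Lemma unit_row_sum (I : finType) (x : I -> A) i :
  \sum_j x j * unit_row j i = x i.
Proof.
rewrite (bigD1 i) //= /unit_row eqxx mulr1 big1 ?addr0 // => j /negbTE ->.
by rewrite mulr0.
Qed.

(** The connecting isomorphism: both places being exact for [N], the homology of [C] at one place is
    that of [M] at the next. *)
Lemma exact_lap_shift (I0 I1 I2 I3 : finType) (P : I1 -> I0 -> A)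
    (Q : I2 -> I1 -> A) (R : I3 -> I2 -> A) M N C
    (i : {linear M -> N}) (p : {linear N -> C}) :
  comp0 P Q -> comp0 Q R -> exact_lap P Q N -> exact_lap Q R N -> ses i p ->
  exact_lap P Q C <-> exact_lap Q R M.
Proof.
move=> PQ QR eP eQ ip; have [ii ps ex] := ip; split=> h v v0.
  have [f fP] : exists f : I1 -> N, forall j, i (v j) = lap Q f j.
    by apply: eQ => k; rewrite -lap_linear v0 linear0.
  have [c cP] : exists c : I0 -> C, forall j, p (f j) = lap P c j.
    by apply: h => k; rewrite -lap_linear -fP (ses0 _ ip).
  have /choice [g gP] := fun k => ps (c k).
  have /choice [m mP] : forall j, exists m, i m = f j - lap P g j.
    move=> j; apply/ex; rewrite linearB cP lap_linear.
    by rewrite (@eq_lap _ _ _ _ _ c) ?subrr.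
  exists m => j; apply: ii; rewrite lap_linear.
  rewrite (@eq_lap _ _ _ _ _ (fun j => f j - lap P g j)) //.
  by rewrite lapB -fP lap_comp0 // subr0.
have /choice [f fP] := fun k => ps (v k).
have /choice [m mP] : forall j, exists m, i m = lap Q f j.
  by move=> j; apply/ex; rewrite lap_linear (@eq_lap _ _ _ _ _ v).
have [w wP] : exists w, forall j, m j = lap Q w j.
  apply: h => k; apply: ii; rewrite lap_linear linear0.
  by rewrite (@eq_lap _ _ _ _ _ (lap Q f)) // lap_comp0.
have [g gP] : exists g, forall j, f j - i (w j) = lap P g j.
  by apply: eP => k; rewrite lapB -mP wP lap_linear subrr.
exists (fun k => p (g k)) => j.
by rewrite -lap_linear -gP linearB fP (ses0 _ ip) subr0.
Qed.

Lemma exact_lap_iso (I J K : finType) (P : J -> I -> A) (Q : K -> J -> A) M N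
    (f : {linear M -> N}) :
  injective f -> onto f -> exact_lap P Q M <-> exact_lap P Q N.
Proof.
move=> fi fs; split=> h v v0.
  have /choice [u uP] := fun k => fs (v k).
  have [w wP] : exists w, forall j, u j = lap P w j.
    apply: h => k; apply: fi; rewrite lap_linear linear0.
    by rewrite (@eq_lap _ _ _ _ _ v).
  exists (fun k => f (w k)) => j.
  by rewrite -lap_linear -wP uP.
have [w wP] : exists w, forall j, f (v j) = lap P w j.
  by apply: h => k; rewrite -lap_linear v0 linear0.
have /choice [u uP] := fun k => fs (w k).
exists u => j; apply: fi; rewrite wP lap_linear.
by apply: eq_lap => k; rewrite uP.
Qed.

(** As [e] respects the row relations of [D], sending [rowm r D] to the sum of the [r i *: e i] is
    well defined on the row space; by injectivity it extends to all of [J -> A]. *)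
Lemma injective_solve (I J : finType) (D : I -> J -> A) E (e : I -> E) :
  injective_module E ->
  (forall r, (forall j, rowm r D j = 0) -> \sum_i r i *: e i = 0) ->
  exists e' : J -> E, forall i, e i = lap D e' i.
Proof.
move=> hE he.
have [||f fP] := @inj_extend A (J -> A^o) E
  (fun x y => exists r, x = rowm r D /\ y = \sum_i r i *: e i) hE.
- split.
    exists (fun=> 0); split; first by apply/funext => j; rewrite rowm0.
    by rewrite big1 // => i _; rewrite scale0r.
  move=> a _ _ _ _ [r [-> ->]] [r' [-> ->]].
  exists (fun i => a * r i + r' i); split.
    by apply/funext => j; rewrite rowm_linear.
  rewrite scaler_sumr -big_split /=; apply: eq_bigr => i _.
  by rewrite scalerDl scalerA.
- move=> _ [r [r0 ->]]; apply: he => j.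
  by rewrite -[LHS]/((rowm r D : J -> A^o) j) -r0.
exists (fun j => f (unit_row j)) => i.
rewrite /lap; transitivity (f (D i)).
  apply/esym/fP; exists (unit_row i); rewrite sum_unit_row; split=> //.
  by apply/funext => j; rewrite rowm_unit_row.
have {1}-> : D i = \sum_j D i j *: (unit_row j : J -> A^o); last first.
  by rewrite linear_sum; apply: eq_bigr => j _; rewrite linearZ.
apply/funext => j.
by rewrite fct_sumE -[LHS](unit_row_sum (D i)).
Qed.

Lemma injective_exact_lap (I J K : finType) (P : J -> I -> A) (Q : K -> J -> A)
    E :
  (forall r, (forall i, rowm r P i = 0) ->
     exists s, forall j, r j = rowm s Q j) ->
  injective_module E -> exact_lap P Q E.
Proof.
move=> h hE v v0; apply: injective_solve => // r /h [s rE].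
under eq_bigr => j _ do rewrite rE.
by rewrite -rowm_lap big1 // => k _; rewrite v0 scaler0.
Qed.

(** Injective modules detect exactness: the quotient of [J -> A] by the rows of [Q] embeds in an
    injective [E]. The images of the unit rows are killed by [Q], hence come through [P], and r P =
    0 makes [r] vanish in the quotient. *)
Lemma exact_lap_rowm (I J K : finType) (P : J -> I -> A) (Q : K -> J -> A) :
  (forall E, injective_module E -> exact_lap P Q E) ->
  forall r, (forall i, rowm r P i = 0) ->
    exists s, forall j, r j = rowm s Q j.
Proof.
move=> h r r0.
have [|M [q [qs qS]]] := @quotient_ex A (J -> A^o)
    (fun x => exists s, forall j, x j = rowm s Q j).
  split.
    by exists (fun=> 0) => j; rewrite rowm0.
  move=> a u v [s us] [s' vs]; exists (fun k => a * s k + s' k) => j.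
  by rewrite rowm_linear -us -vs.
have [E [t [hE ti]]] := enough_injectives M.
have qE (x : J -> A^o) : t (q x) = \sum_j (x j : A) *: t (q (unit_row j)).
  have {1}-> : x = \sum_j (x j : A) *: (unit_row j : J -> A^o).
    by apply/funext => j; rewrite fct_sumE -[LHS](unit_row_sum x).
  by rewrite !linear_sum; apply: eq_bigr => j _; rewrite !linearZ.
have [|w wP] := h E hE (fun j => t (q (unit_row j))).
  move=> k; rewrite /lap -(qE (Q k)).
  have -> : q (Q k) = 0.
    by apply/qS; exists (unit_row k) => j; rewrite rowm_unit_row.
  exact: linear0.
have /qS // : q r = 0.
apply: ti; rewrite linear0 qE.
under eq_bigr => j _ do rewrite wP.
by rewrite rowm_lap big1 // => i _; rewrite r0 scale0r.
Qed.

(** The system is solved one dual-basis coordinate at a time; [J] is finite, so the coordinates of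
    all [v j] have a common finite support [t]. *)
Lemma projective_exact_lap (I J K : finType) (P : J -> I -> A)
    (Q : K -> J -> A) F :
  projective F -> exact_lap P Q A^o -> exact_lap P Q F.
Proof.
move=> [X [b [c bc]]] h v v0.
have /choice [y yP] : forall x, exists y : I -> A^o,
    forall j, c x (v j) = lap P y j.
  by move=> x; apply: h => k; rewrite -lap_linear v0 linear0.
have /choice [s sP] := fun j => bc (v j).
pose t := undup (flatten [seq s j | j : J]).
have st j : {subset s j <= t}.
  move=> x xs; rewrite mem_undup; apply/flattenP; exists (s j) => //.
  by apply: map_f; rewrite mem_enum.
exists (fun i => \sum_(x <- t) (y x i : A) *: b x) => j.
have [us c0 ->] := sP j.
rewrite (@dual_basis_sub A F X c (v j) F b (s j) t) ?undup_uniq //; last first.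
  by move=> x xt; apply: c0; apply: contra xt => /st.
rewrite /lap; under [RHS]eq_bigr => i _ do rewrite scaler_sumr.
rewrite exchange_big /=; apply: eq_bigr => x _.
rewrite yP /lap scaler_suml; apply: eq_bigr => i _.
by rewrite scalerA.
Qed.

End Matrices.

Arguments unit_row {A I}.

Section Resolutions.
Variable B : pzRingType.
Implicit Types (V M C E F G : lmodType B).

Definition noetherian_ring := forall L : B -> Prop, @smod B B^o L ->
  exists (J : finType) (g : J -> B),
    forall b, L b <-> exists s : J -> B, b = \sum_j s j * g j.

Hypothesis hB : noetherian_ring.

(** Elimination of one coordinate [x] at a time: lift generators of the ideal of [x]-th coordinates,
    and add generators of the vectors that vanish at [x]. *)
Lemma noetherian_rows (I : finType) (S : (I -> B^o) -> Prop) : smod S ->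
  exists (J : finType) (g : J -> I -> B),
    forall v : I -> B^o, S v <-> exists s, forall i, v i = rowm s g i.
Proof.
move=> hS.
suff H (l : seq I) : forall S : (I -> B^o) -> Prop, smod S ->
    (forall v, S v -> forall i, i \notin l -> v i = 0) ->
    exists (J : finType) (g : J -> I -> B),
      forall v : I -> B^o, S v <-> exists s, forall i, v i = rowm s g i.
  by apply: (H (enum I)) => // v _ i; rewrite mem_enum.
elim: l => [|x l IH] {}S {}hS Sl.
  exists void, (fun v : void => match v with end) => v; split.
    move=> /Sl v0; exists (fun v : void => match v with end) => i.
    by rewrite v0 // /rowm big1 // => -[].
  move=> [s vs]; have -> : v = 0.
    by apply/funext => i; rewrite vs /rowm big1 // => -[].
  exact: smod0 hS.
have [|J1 [g1 g1P]] := hB (L := fun b => exists v, S v /\ v x = b).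
  split; first by exists 0; split=> //; exact: smod0 hS.
  move=> a _ _ [u [Su <-]] [v [Sv <-]]; exists (a *: u + v); split=> //.
  by case: hS => _; apply.
have /choice [h hP] : forall j, exists v, S v /\ v x = g1 j.
  move=> j; apply/g1P; exists (unit_row j).
  by rewrite -[RHS]/(\sum_k _ *: (g1 k : B^o)) sum_unit_row.
have [||J2 [g2 g2P]] := IH (fun v => S v /\ v x = 0).
- split; first by split=> //; exact: smod0 hS.
  move=> a u v [Su u0] [Sv v0]; split; first by case: hS => _; apply.
  by rewrite /+%R /= /GRing.scale /= u0 v0 scaler0 addr0.
- move=> v [Sv v0] i il; have [->//|ix] := eqVneq i x.
  by apply: Sl => //; rewrite inE negb_or ix il.
have g2S j : S (g2 j).
  have /g2P [] // : exists s, forall i, g2 j i = rowm s g2 i.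
  by exists (unit_row j) => i; rewrite rowm_unit_row.
exists (J1 + J2)%type, (fun j => match j with inl j => h j | inr j => g2 j end).
move=> v; split.
  move=> Sv; have /g1P [s1 s1P] : exists w, S w /\ w x = v x by exists v.
  have /g2P [s2 s2P] :
      S (v - \sum_j s1 j *: h j) /\ (v - \sum_j s1 j *: h j) x = 0.
    split.
      apply: (smodB hS Sv); apply: (smod_sum hS) => j _.
      by apply: (smodZ hS); case: (hP j).
    rewrite /+%R /= /-%R /= fct_sumE s1P.
    apply/eqP; rewrite subr_eq0; apply/eqP.
    by apply: eq_bigr => j _; rewrite -(proj2 (hP j)).
  exists (fun j => match j with inl j => s1 j | inr j => s2 j end) => i.
  rewrite /rowm big_sumType /=; have := s2P i; rewrite /rowm => <-.
  by rewrite {2}/+%R /= /-%R /= fct_sumE addrC subrK.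
move=> [s sP]; have -> : v = \sum_j s (inl j) *: h j +
    \sum_j s (inr j) *: (g2 j : I -> B^o).
  apply/funext => i; rewrite sP /rowm big_sumType /=.
  by rewrite /+%R /= !fct_sumE.
apply: (smodD hS); apply: (smod_sum hS) => j _.
  by apply: (smodZ hS); case: (hP j).
exact: (smodZ hS _ (g2S j)).
Qed.

(* A resolution of [B / L] by finitely generated free modules, whose zeroth
   term is [B] itself. *)
Definition resolution (L : B -> Prop) (K : nat -> finType)
    (D : forall n, K n.+1 -> K n -> B) (u : K 0%N) :=
  [/\ forall x, x = u,
      forall b, L b <-> exists s, b = rowm s (D 0%N) u &
      forall n r, (forall x, rowm r (D n) x = 0) <->
        exists s, forall x, r x = rowm s (D n.+1) x].

Lemma resolution_ex (L : B -> Prop) : @smod B B^o L ->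
  exists (K : nat -> finType) (D : forall n, K n.+1 -> K n -> B) (u : K 0%N),
    resolution L D u.
Proof.
move=> /hB [J0 [g0 g0P]].
(* A state holds the last matrix with its two index types; [nx] gives the matrix whose rows generate
   the relations among its rows. *)
pose St := {I : finType & {J : finType & J -> I -> B}}.
have nxP : forall s : St,
    exists s' : {J : finType & J -> projT1 (projT2 s) -> B},
      forall r, (forall x, rowm r (projT2 (projT2 s)) x = 0) <->
        exists t, forall x, r x = rowm t (projT2 s') x.
  move=> [I [J D]] /=.
  have [|J' [g gP]] := @noetherian_rows J (fun r => forall x, rowm r D x = 0).
    split.
      by move=> x; rewrite rowm0.
    move=> a r r' h h' x; rewrite -[LHS]/(rowm (fun j => a * r j + r' j) D x).
    apply: etrans (rowm_linear D a r r' x) _.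
    apply: etrans (congr2 (fun y z => a * y + z) (h x) (h' x)) _.
    by rewrite mulr0 addr0.
  by exists (existT _ J' g).
pose nx s := sval (cid (nxP s)).
pose st n : St := iter n (fun s => existT _ (projT1 (projT2 s)) (nx s))
  (existT _ (unit : finType) (existT _ J0 (fun j _ => g0 j))).
exists (fun n => projT1 (st n)), (fun n => projT2 (projT2 (st n))), tt.
split; first by case.
  exact: g0P.
by move=> n r; exact: (svalP (cid (nxP (st n)))).
Qed.

Section Theory.
Variables (L : B -> Prop) (K : nat -> finType).
Variables (D : forall n, K n.+1 -> K n -> B) (u : K 0%N).
Arguments D : clear implicits.
Hypothesis hD : resolution L D u.

Lemma resolution_comp0 n : comp0 (D n) (D n.+1).
Proof.
move=> k i; have [_ _ h] := hD.
have -> : \sum_j D n.+1 k j * D n j i = rowm (D n.+1 k) (D n) i by [].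
by move: i; apply/h; exists (unit_row k) => x; rewrite rowm_unit_row.
Qed.

(* The [n.+1]-st extension group of [B / L] by [M] vanishes. *)
Definition ext_res n M := exact_lap (D n) (D n.+1) M.

Lemma ext_res_injective n E : injective_module E -> ext_res n E.
Proof.
move=> hE; have [_ _ h] := hD; apply: injective_exact_lap => // r.
by move/h.
Qed.

Lemma ext_res_csyz m n M G : csyz n M G -> ext_res m G <-> ext_res (n + m) M.
Proof.
elim: n M m => [|n IH] M m.
  move=> [f [fi fs]]; rewrite add0n; apply: iff_sym.
  exact: exact_lap_iso fi fs.
move=> [I [C [i [p [hI ip /IH ->]]]]]; rewrite addSn.
exact: (exact_lap_shift (@resolution_comp0 _) (@resolution_comp0 _)
  (@ext_res_injective _ _ hI) (@ext_res_injective _ _ hI) ip).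
Qed.

End Theory.

(** Baer's criterion by generators and relations: the values [m j] of a partial map on generators of
    its domain satisfy every relation, so Ext^1(B/L, E) = 0 writes them as multiples of the single
    element [s u]. *)
Lemma ext_res_baer E :
  (forall L K D u, @resolution L K D u -> ext_res D 0 E) -> injective_module E.
Proof.
move=> hE; apply: baer => R [R00 lR] fR.
have [|K [D [u hD]]] := @resolution_ex (fun b => exists e, R b e).
  split; first by exists 0.
  by move=> a x y [e he] [e' he']; exists (a *: e + e'); apply: lR.
have [uP LP ex] := hD.
have RD (I : finType) (s x : I -> B) (m : I -> E) :
    (forall j, R (x j) (m j)) -> R (\sum_j s j * x j) (\sum_j s j *: m j).
  move=> h; apply: (big_ind2 R) => // [x1 x2 y1 y2 h1 h2|j _].
    by have := lR 1 _ _ _ _ h1 h2; rewrite !scale1r.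
  by have := lR (s j) _ _ _ _ (h j) R00; rewrite !addr0.
have /choice [m mP] : forall j, exists e, R (D 0%N j u) e.
  by move=> j; apply/LP; exists (unit_row j); rewrite rowm_unit_row.
have [|s sP] := hE _ _ _ _ hD m.
  move=> k; apply: fR; have := RD _ (D 1%N k) _ _ mP.
  by rewrite (resolution_comp0 hD).
exists (s u) => a e h; have [|t tE] := proj1 (LP a); first by exists e.
have h' : R a (\sum_j t j *: m j) by rewrite tE; apply: RD.
have := lR (-1) _ _ _ _ h' h; rewrite !scaleN1r addNr => /fR /eqP.
rewrite addrC subr_eq0 => /eqP ->; rewrite tE /rowm scaler_suml.
apply: eq_bigr => j _; rewrite sP /lap (bigD1 u) //= big1 ?addr0.
  by rewrite scalerA.
by move=> x; rewrite (uP x) eqxx.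
Qed.

(** Ext^{n+1}(B/L, -) vanishes on [B], hence on all projective modules, because the resolution
    consists of finitely generated free modules. *)
Lemma csyz_projective_injective n G0 F G :
  csyz n B^o G0 -> injective_module G0 -> projective F -> csyz n F G ->
  injective_module G.
Proof.
move=> BG0 hG0 hF FG; apply: ext_res_baer => L K D u hD.
apply/(ext_res_csyz hD 0 FG)/projective_exact_lap => //.
exact/(ext_res_csyz hD 0 BG0)/(ext_res_injective hD).
Qed.

End Resolutions.

(** * Extensions by the regular module and torsion *)

Section Tor.
Variables (A : pzRingType) (L : A^c -> Prop) (K : nat -> finType).
Variables (D : forall n, K n.+1 -> K n -> A^c) (u : K 0%N).
Arguments D : clear implicits.
Hypothesis hD : resolution L D u.
Implicit Types (V M C E F G X P : lmodType A).

(** Tensoring with [V] makes [D n] send vectors over [K n.+1] to vectors over [K n], the entries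
    acting on [V] as elements of [A]. *)
Definition transpose n (x : K n) (y : K n.+1) : A := D n y x.

(* The [n.+1]-st torsion group of [A / L] and [V] vanishes. *)
Definition tor_res n V := exact_lap (transpose (n := n.+1)) (@transpose n) V.

Lemma transpose_comp0 n : comp0 (@transpose n.+1) (@transpose n).
Proof. by move=> k i; exact: (resolution_comp0 hD i k). Qed.

Lemma tor_res_projective n P : projective P -> tor_res n P.
Proof.
move=> hP; apply: projective_exact_lap => // v v0; have [_ _ h] := hD.
(* On the regular module, [lap] of the transpose over [A] is [rowm] over [A^c], so this is exactness
   of the resolution. *)
exact: (proj1 (h n v) v0).
Qed.

Lemma tor_res_syzygy m n X : tor_res m (iter n (@Om A) X) <-> tor_res (n + m) X.
Proof.
elim: n m => [|n IH] m; first by rewrite add0n.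
rewrite addSn -addnS -IH; apply: iff_sym; rewrite iterS.
exact: (exact_lap_shift (@transpose_comp0 _) (@transpose_comp0 _)
  (@tor_res_projective _ _ (Fr_projective _))
  (@tor_res_projective _ _ (Fr_projective _)) (Om_ses _)).
Qed.

(* [Hom(-, E)] turns the complex computing the extensions of [A / L] by [A]
   into the complex computing the torsion of [A / L] and [E]. *)
Lemma ext_tor_res n :
  ext_res D n (A^c)^o <-> forall E, injective_module E -> tor_res n E.
Proof.
split=> [h E hE|h].
  by apply: injective_exact_lap => // r; exact: h.
exact: (exact_lap_rowm h).
Qed.

End Tor.

Section Duality.
Variable A : pzRingType.
Hypothesis hA : noetherian_ring A^c.

Lemma csyz_regular_injective n (G : lmodType A^c) :
  (forall E : lmodType A,
     injective_module E -> projective (iter n (@Om A) E)) ->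
  csyz n (A^c)^o G -> injective_module G.
Proof.
move=> hE AG; apply: (ext_res_baer hA) => L K D u hD.
apply/(ext_res_csyz hD 0 AG); rewrite addn0.
apply: (proj2 (ext_tor_res D n)) => E hI.
by rewrite -[n]addn0; apply/(tor_res_syzygy hD)/(tor_res_projective hD)/hE.
Qed.

Lemma injective_tor_res n (G : lmodType A^c) L K D u (E : lmodType A) :
  csyz n (A^c)^o G -> injective_module G -> @resolution A^c L K D u ->
  injective_module E -> tor_res D 0 (iter n (@Om A) E).
Proof.
move=> AG hG hD hE; apply/(tor_res_syzygy hD); rewrite addn0.
apply: (proj1 (ext_tor_res D n)) => //.
by rewrite -[n]addn0; apply/(ext_res_csyz hD 0 AG)/(ext_res_injective hD).
Qed.

End Duality.

(** * Projectivity over rings with nilpotent radical *)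

Section RadicalProducts.
Variables (A : pzRingType) (J : A -> Prop).
Implicit Types (U V W M N C X P E F G K : lmodType A).

(** The submodule J S as an intersection of submodules, which gives its induction principle without
    finite sums. *)
Definition radical_mul V (S : V -> Prop) (x : V) : Prop :=
  forall W : V -> Prop, smod W -> (forall a s, J a -> S s -> W (a *: s)) -> W x.

Definition radical_power n : A -> Prop :=
  iter n (@radical_mul A^o) (fun=> True).

Lemma smod_radical_mul V (S : V -> Prop) : smod (radical_mul S).
Proof.
split; first by move=> W hW _; exact: smod0 hW.
move=> a u v hu hv W hW h.
by apply: (smodD hW); [apply: (smodZ hW); apply: hu | apply: hv].
Qed.

Lemma radical_mulP V (S : V -> Prop) a s : J a -> S s -> radical_mul S (a *: s).
Proof. by move=> Ja Ss W _; apply. Qed.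

Lemma radical_mul_mono V (S S' : V -> Prop) :
  (forall x, S x -> S' x) -> forall x, radical_mul S x -> radical_mul S' x.
Proof.
move=> SS' x hx W hW h; apply: (hx W hW) => a s Ja /SS'; exact: h.
Qed.

Lemma radical_mul_map V M (f : {linear V -> M}) (S : V -> Prop)
    (S' : M -> Prop) :
  (forall x, S x -> S' (f x)) ->
  forall x, radical_mul S x -> radical_mul S' (f x).
Proof.
move=> SS' x hx; apply: (hx (fun x => radical_mul S' (f x))).
  have [h0 hl] := smod_radical_mul S'; split; first by rewrite linear0.
  by move=> a u v hu hv; rewrite linearP; apply: hl.
by move=> a s Ja Ss; rewrite linearZ; apply: radical_mulP => //; apply: SS'.
Qed.

Lemma radical_mul_sub V (S : V -> Prop) x : smod S -> radical_mul S x -> S x.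
Proof. by move=> hS hx; apply: (hx S) => // a s _; exact: smodZ. Qed.

Hypothesis hJl : @smod A A^o J.
Hypothesis hJr : forall x a, J x -> J (x * a).

Lemma radical_mul_regular x : @radical_mul A^o (fun=> True) x -> J x.
Proof. by move=> hx; apply: (hx J) => // a s Ja _; exact: hJr. Qed.

(** Compares the iterated product J(J(... S)) with the ideal power J^n acting on [S]. The induction
    passes to [W'], the elements that [J] sends into [W], a submodule because [J] is a right
    ideal. *)
Lemma iter_radical_mul n V (S W : V -> Prop) x :
  smod W -> (forall a s, radical_power n a -> S s -> W (a *: s)) ->
  iter n (@radical_mul V) S x -> W x.
Proof.
move=> hW; elim: n W hW x => [|n IH] W hW x h /=.
  by move=> Sx; rewrite -[x]scale1r; apply: h.
move=> hx; apply: (hx W) => // a s Ja; pose W' y := forall a, J a -> W (a *: y).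
have hW' : smod W'.
  split; first by move=> b _; rewrite scaler0; exact: smod0 hW.
  move=> c u v hu hv b Jb; rewrite scalerDr scalerA.
  by apply: (smodD hW); [apply/hu/hJr | apply: hv].
move=> hs; move: a Ja; apply: (IH W' hW') hs => b t Jb St a Ja.
by rewrite scalerA; apply: h => //; exact: (@radical_mulP A^o).
Qed.

Lemma radical_power_mulr n a b :
  radical_power n a -> J b -> radical_power n.+1 (a * b).
Proof.
elim: n a => [|n IH] a ha Jb.
  rewrite -[a * b]mulr1; apply: (@radical_mulP A^o) => //.
  exact: (smodZ hJl).
have [|f fE] := @linear_of_fun A A^o A^o (fun x : A => x * b).
  by move=> c u v; rewrite /GRing.scale /= mulrDl mulrA.
rewrite -[a * b]fE.
by apply: (radical_mul_map (f := f)) ha => x hx; rewrite fE; apply: IH.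
Qed.

Hypothesis nilJ : exists n, forall x, radical_power n x -> x = 0.

Lemma iter_radical_mul0 V (S : V -> Prop) :
  exists n, forall x, iter n (@radical_mul V) S x -> x = 0.
Proof.
have [n hn] := nilJ; exists n => x.
apply: (@iter_radical_mul n V S (fun x => x = 0)).
  by split=> // a u v -> ->; rewrite scaler0 addr0.
by move=> a s /hn -> _; rewrite scale0r.
Qed.

(* Semisimplicity of [A / J]: every left ideal containing [J] is generated
   modulo [J] by an idempotent of [A / J]. *)
Definition semisimple_modulo := forall L : A -> Prop, @smod A A^o L ->
  (forall x, J x -> L x) -> exists e, L e /\ forall a, L a -> J (a - a * e).

Hypothesis ssJ : semisimple_modulo.

(** To add [x] to the domain, take [e] that generates modulo [J] the ideal of all [a] with [a *: x]
    in the domain, and give [x] the value of the map at [e *: x]. The error terms lie in [J] and are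
    sent to 0. *)
Lemma semisimple_extend F E (G0 : F -> E -> Prop) :
  lin_rel G0 -> functional_rel G0 ->
  (forall a x, J a -> G0 (a *: x) 0) ->
  exists f : {linear F -> E}, forall x e, G0 x e -> f x = e.
Proof.
move=> lG0 fG0 JG; apply: lin_rel_extend => // G G0G [G00 lG] fG x.
have [||e [[m Gm] eP]] := ssJ (L := fun a => exists m, G (a *: x) m).
- split; first by exists 0; rewrite scale0r.
  move=> a b c [m hm] [m' hm']; exists (a *: m + m').
  by rewrite scalerDl -scalerA; apply: lG.
- by move=> a Ja; exists 0; apply/G0G/JG.
exists m => a m' h.
have /eP /(JG _ x) /G0G h0 : exists m, G (a *: x) m by exists m'.
have := lG a _ _ _ _ Gm h0; rewrite scalerA -scalerDl addrC subrK addr0 => h1.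
have := lG (-1) _ _ _ _ h1 h; rewrite !scaleN1r addNr => /fG /eqP.
by rewrite addrC subr_eq0 => /eqP.
Qed.

(** The quotient of [K] by the preimage of J F embeds into F / J F, which is semisimple. A
    retraction exists there, and it lifts to [t] since [F] is projective. *)
Lemma top_retraction K F (i : {linear K -> F}) : projective F ->
  exists t : {linear F -> K},
    forall k, radical_mul (fun=> True) (i (k - t (i k))).
Proof.
move=> hF; pose JF := @radical_mul F (fun=> True).
have hJF : smod JF by exact: smod_radical_mul.
have [|M [q [qs qP]]] := @quotient_ex A K (fun k => JF (i k)).
  split; first by rewrite linear0; exact: smod0 hJF.
  by move=> a u v hu hv; rewrite linearP; case: hJF => _; apply.
have [|||f fP] := @semisimple_extend F M
  (fun x m => exists k z, [/\ JF z, x = i k + z & m = q k]).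
- split.
    exists 0, 0; split; [exact: smod0 hJF|by rewrite linear0 addr0|].
    by rewrite linear0.
  move=> a _ _ _ _ [k [z [hz -> ->]]] [k' [z' [hz' -> ->]]].
  exists (a *: k + k'), (a *: z + z'); split.
  + by case: hJF => _; apply.
  + by rewrite scalerDr linearP addrACA.
  + by rewrite linearP.
- move=> _ [k [z [hz /esym /eqP kz ->]]]; apply/qP.
  by move: kz; rewrite addr_eq0 => /eqP ->; exact: (smodN hJF).
- move=> a x Ja; exists 0, (a *: x); split; first exact: radical_mulP.
    by rewrite linear0 add0r.
  by rewrite linear0.
have [t tP] := projective_lift f hF qs.
exists t => k; apply/qP; rewrite linearB tP (fP (i k) (q k)) ?subrr //.
by exists k, 0; split=> //; [exact: smod0 hJF | rewrite addr0].
Qed.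

(** With u = 1 - t i and u^n = 0, the map r = (1 + u + ... + u^{n-1}) t satisfies r i = 1 - u^n =
    1. *)
Lemma nilpotent_retraction K F (i : {linear K -> F}) (t : {linear F -> K}) n :
  (forall k, iter n (fun k => k - t (i k)) k = 0) ->
  exists r : {linear F -> K}, forall k, r (i k) = k.
Proof.
move=> nil; pose u : {linear K -> K} := idfun \- (t \o i).
suff [r rP] : exists r : {linear F -> K}, forall k, r (i k) = k - iter n u k.
  by exists r => k; rewrite rP nil subr0.
elim: (n) => [|m [r rP]]; first by exists \0 => k; rewrite subrr.
exists (t \+ (u \o r)) => k /=; rewrite rP.
rewrite -[_ - t _]/(u (k - iter m u k)) linearB [u k]/=.
by rewrite addrA [t _ + _]addrC subrK.
Qed.

Lemma retraction_projective K F X (i : {linear K -> F}) (p : {linear F -> X})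
    (r : {linear F -> K}) :
  ses i p -> (forall k, r (i k) = k) -> projective F -> projective X.
Proof.
move=> ip rP hF; have [ii ps ex] := ip.
have [|s sP] := factor_onto (f := idfun \- (i \o r)) ps.
  by move=> v /ex [k <-] /=; rewrite rP subrr.
apply: (@projective_retract A X F s p) => // x.
have [v <-] := ps x.
by rewrite sP /= linearB (ses0 _ ip) subr0.
Qed.

(* With [t] as in [top_retraction] and [u k = k - t k], every linear map
   [f : Om X -> J] satisfies [f (u^n k) \in J^n]: it extends to [Fr X], and the
   coordinates of [u^n k] are themselves values of such maps at [u^(n-1) k].
   Hence [u] is nilpotent, and [Om X] is a direct summand of [Fr X]. *)
Lemma ext1_radical_projective (RJ : lmodType A) (j : {linear RJ -> A^o}) X :
  injective j -> (forall a, J a <-> exists y, j y = a) ->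
  ext1_zero X RJ -> projective X.
Proof.
move=> ji jP eX; have [oi os oex] := Om_ses X.
have hF := Fr_projective X; have [I [b [c bc]]] := hF.
have [t tP] := top_retraction (om_in X) hF.
pose u : {linear Om X -> Om X} := idfun \- (t \o om_in X).
have coord x : exists h : {linear Om X -> RJ},
    forall k, j (h k) = c x (om_in X (u k)).
  apply: (factor_inj (f := c x \o (om_in X \o u)) ji) => k; apply/jP.
  by apply/radical_mul_regular; apply: (radical_mul_map (f := c x)) (tP k).
have pow m (f : {linear Om X -> RJ}) k : radical_power m (j (f (iter m u k))).
  elim: m f => [|m IH] f //; have [g gP] := eX f.
  rewrite -gP; have [s [us c0 ->]] := bc (om_in X (iter m.+1 u k)).
  rewrite !linear_sum; apply: (@smod_sum A A^o _ (smod_radical_mul _)) => x _.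
  rewrite !linearZ; apply: radical_power_mulr; last first.
    by apply/jP; exists (g (b x)).
  by have [h hP] := coord x; rewrite iterS -hP.
have [n hn] := nilJ.
(* One step more than the exponent [n] with J^n = 0: the coordinates of u^{n+1} k are values at u^n
   k of maps into [J]. *)
have [|r rP] := @nilpotent_retraction _ _ (om_in X) t n.+1.
  move=> k; rewrite -[LHS]/(iter n.+1 u k); apply: oi; rewrite linear0.
  have [s [us c0 ->]] := bc (om_in X (iter n.+1 u k)).
  rewrite big1 // => x _; have [h hP] := coord x.
  by rewrite iterS -hP (hn (j _) (pow _ _ _)) scale0r.
exact: retraction_projective (Om_ses X) rP hF.
Qed.

(** The hypothesis says that Om X meets J Fr X in J Om X, that is, Tor_1(A/J, X) = 0. Then [u] maps
    J^m Om X into J^{m+1} Om X, so it is nilpotent. *)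
Lemma tor_radical_projective X :
  (forall k,
     radical_mul (fun=> True) (om_in X k) -> radical_mul (fun=> True) k) ->
  projective X.
Proof.
move=> tor; have hF := Fr_projective X.
have [t tP] := top_retraction (om_in X) hF.
pose u : {linear Om X -> Om X} := idfun \- (t \o om_in X).
have [n hn] := iter_radical_mul0 (fun _ : Om X => True).
have [|r rP] := @nilpotent_retraction _ _ (om_in X) t n.
  move=> k; apply: hn; rewrite -[iter _ _ k]/(iter n u k).
  have step m x : iter m (@radical_mul (Om X)) (fun=> True) x ->
      iter m.+1 (@radical_mul (Om X)) (fun=> True) (u x).
    elim: m x => [|m IH] x; first by move=> _; apply: (tor (u x)); exact: tP.
    exact: radical_mul_map.
  by elim: (n) => [|m IH] //; apply: step.
exact: retraction_projective (Om_ses X) rP hF.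
Qed.

(** The first matrix lists generators [d j] of [J] as a right ideal. If [k] in Om X is a sum of
    [d j *: f j] in the free cover, the images of the [f j] in [X] satisfy a relation, which by
    Tor_1 = 0 comes from the resolution; correcting the [f j] accordingly moves them into Om X. *)
Lemma tor_res_radical (K : nat -> finType)
    (D : forall n, K n.+1 -> K n -> A^c) (z : K 0%N) X :
  @resolution A^c J K D z -> tor_res D 0 X -> projective X.
Proof.
move=> hD tX; apply: tor_radical_projective => k.
have [zP LP ex] := hD; have [oi os oex] := Om_ses X.
pose d (j : K 1%N) : A := D 0%N j z.
have dJ j : J (d j).
  by apply/LP; exists (unit_row j); rewrite rowm_unit_row.
have lapE V (f : K 1%N -> V) x :
    lap (@transpose A K D 0) f x = \sum_j d j *: f j.
  by rewrite (zP x).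
have fin x : radical_mul (fun=> True) x ->
    exists f : K 1%N -> Fr X, x = \sum_j d j *: f j.
  move=> hx.
  apply: (hx (fun x => exists f : K 1%N -> Fr X, x = \sum_j d j *: f j)).
    split; first by exists (fun=> 0); rewrite big1 // => j _; rewrite scaler0.
    move=> a _ _ [f ->] [g ->].
    (* [J] is also a left ideal, so [a * d j] is again a combination of the [d l] with coefficients
       on the right. *)
    have /choice [s sP] : forall j, exists s : K 1%N -> A,
        a * d j = \sum_l d l * s l.
      move=> j; have /LP [s sE] : J (a * d j) by exact: (smodZ hJl).
      by exists s.
    exists (fun l => \sum_j s j l *: f j + g l).
    rewrite scaler_sumr.
    under eq_bigr => j _ do rewrite scalerA sP scaler_suml.
    rewrite exchange_big -big_split; apply: eq_bigr => l _ /=.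
    rewrite scalerDr scaler_sumr; congr (_ + _); apply: eq_bigr => j _.
    by rewrite scalerA.
  move=> a y Ja _; have /LP [s sE] := Ja.
  exists (fun j => (s j : A) *: y); rewrite sE /rowm scaler_suml.
  by apply: eq_bigr => j _; rewrite scalerA.
move=> /fin [f fE].
have [|y yP] := tX (fun j => fr_pr X (f j)).
  by move=> x; rewrite -lap_linear lapE -fE (ses0 _ (Om_ses X)).
have /choice [g gP] := fun l => os (y l).
have /choice [m mP] : forall j, exists m,
    om_in X m = f j - lap (@transpose A K D 1) g j.
  move=> j; apply/oex; rewrite linearB yP lap_linear.
  by rewrite (@eq_lap _ _ _ _ _ _ y) ?subrr.
have -> : k = \sum_j d j *: m j.
  apply: oi; rewrite fE linear_sum.
  under [RHS]eq_bigr => j _ do rewrite linearZ mP /= scalerBr.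
  rewrite sumrB -!(lapE _ _ z) lap_comp0 ?subr0 //.
  exact: (@transpose_comp0 A J K D z hD 0).
apply: (@smod_sum A _ _ (smod_radical_mul _)) => j _.
exact: radical_mulP.
Qed.

End RadicalProducts.

(** * Artinian rings *)

Section Artinian.
Variable A : pzRingType.
Implicit Types (L : A -> Prop).
Local Notation lideal := (@smod A A^o).

Definition left_artinian := forall I : nat -> A -> Prop,
  (forall n, lideal (I n)) -> (forall n x, I n.+1 x -> I n x) ->
  exists n, forall m, (n <= m)%N -> forall x, I n x -> I m x.

Hypothesis artA : left_artinian.

Lemma artinian_min (Q : (A -> Prop) -> Prop) L0 :
  (forall L, Q L -> lideal L) -> Q L0 ->
  exists L, Q L /\ forall L', Q L' -> (forall x, L' x -> L x) ->
    forall x, L x -> L' x.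
Proof.
move=> Qi Q0; apply: contrapT => nmin.
have /choice [f fP] : forall L : {L | Q L}, exists L' : {L | Q L},
    (forall x, sval L' x -> sval L x) /\
    ~ (forall x, sval L x -> sval L' x).
  move=> [L QL]; apply: contrapT => nL; apply: nmin; exists L; split=> //.
  move=> L' QL' sub; apply: contrapT => nsub; apply: nL.
  by exists (exist _ L' QL').
pose I n := iter n f (exist _ L0 Q0).
have [n|n|n nP] := artA (I := fun n => sval (I n)).
- exact/Qi/(svalP (I n)).
- exact: (proj1 (fP (I n))).
- by apply: (proj2 (fP (I n))); apply: (nP n.+1).
Qed.

Lemma maximal_left_ideal_pred (I : {pred A}) :
  maximal_left_ideal I -> lideal (fun x => x \in I).
Proof. by case=> [[]]. Qed.

Lemma maximal_left_idealP (I : {pred A}) x :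
  maximal_left_ideal I -> x \notin I ->
  forall y, exists a z, z \in I /\ y = a * x + z.
Proof.
move=> mI xI y; have hI := maximal_left_ideal_pred mI.
have [_ _ max] := mI.
pose K : {pred A} := fun y => `[< exists a z, z \in I /\ y = a * x + z >].
have [||KI|KT] := max K.
- split.
    apply/asboolP; exists 0, 0; rewrite mul0r addr0; split=> //.
    exact: smod0 hI.
  move=> a _ _ /asboolP [b [z [zI ->]]] /asboolP [b' [z' [zI' ->]]].
  apply/asboolP; exists (a * b + b'), (a * z + z'); split.
    by case: hI => _; apply.
  by rewrite /GRing.scale /= mulrDr mulrDl mulrA addrACA.
- by move=> z zI; apply/asboolP; exists 0, z; rewrite mul0r add0r.
- case/negP: xI; rewrite -KI; apply/asboolP; exists 1, 0.
  by rewrite mul1r addr0; split=> //; exact: smod0 hI.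
- by have /asboolP : y \in K by rewrite KT.
Qed.

Lemma maximal_left_ideal_ex L : lideal L -> ~ L 1 ->
  exists I : {pred A}, maximal_left_ideal I /\ forall x, L x -> x \in I.
Proof.
move=> hL L1; pose R (X : set A) x := L x \/ X x.
pose good (X : set A) := lideal (R X) /\ ~ R X 1.
have [|X [[lX X1] maxX]] := @Zorn_bigcup A good.
  move=> Fam Fgood tot.
  have amb x y : R (\bigcup_(X in Fam) X)%classic x ->
      R (\bigcup_(X in Fam) X)%classic y ->
      exists Z, [/\ good Z, R Z x, R Z y &
        forall z, R Z z -> R (\bigcup_(X in Fam) X)%classic z].
    have up Z : Fam Z -> forall z, R Z z -> R (\bigcup_(X in Fam) X)%classic z.
      by move=> FZ z [?|Zz]; [left | right; exists Z].
    move=> [Lx|[X FX Xx]] [Ly|[Y FY Yy]].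
    - exists set0; split; [|by left|by left|by move=> z [?|[]]; left].
      have E0 z : R set0 z -> L z by case.
      split; last by move=> /E0.
      split; first by left; exact: smod0 hL.
      by move=> a u v /E0 h /E0 h'; left; case: hL => _; apply.
    - by exists Y; split; [exact: Fgood|left|right|exact: up].
    - by exists X; split; [exact: Fgood|right|left|exact: up].
    have [XY|YX] := tot _ _ FX FY.
      by exists Y; split; [exact: Fgood|right; exact: XY|right|exact: up].
    by exists X; split; [exact: Fgood|right|right; exact: YX|exact: up].
  split; first split.
  - by left; exact: smod0 hL.
  - move=> a x y h h'; have [Z [[[_ lZ] _] hx hy up]] := amb _ _ h h'.
    by apply: up; apply: lZ.
  - by move=> h; have [Z [[_ Z1] hx _ _]] := amb _ _ h h; apply: Z1.
exists (fun x => `[< R X x >]); split; last by move=> x Lx; apply/asboolP; left.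
split.
- exact: smod_closed lX.
- by move=> /(_ 1); rewrite inE => /asboolP.
move=> K [K0 lK] sub.
have [K1|nK1] := pselect (1 \in K).
  by right=> x; rewrite inE -[x]mulr1 -[_ * 1]addr0; apply: lK.
left=> x; apply/idP/idP => [xK|/sub //].
apply/asboolP; right; apply: contrapT => nXx.
have RK z : R (fun z => z \in K) z <-> z \in K.
  by split=> [[Lz|//]|]; [apply/sub/asboolP; left | right].
apply: (maxX (fun z => z \in K)).
  split; last by move=> /(_ x xK).
  by move=> z Xz; apply/sub/asboolP; right.
split; last by move/RK.
split; first exact/RK.
by move=> a u v /RK hu /RK hv; apply/RK/lK.
Qed.

Local Notation J := (fun x : A => x \in jacobson A).

Lemma jacobson_smod : lideal J.
Proof. by have [] := jacobson_left A. Qed.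

Lemma jacobson_left_inverse y : J y -> exists b, b * (1 - y) = 1.
Proof.
move=> Jy; apply: contrapT => nb.
have [||I [mI LI]] :=
    @maximal_left_ideal_ex (fun x => exists b, x = b * (1 - y)).
- split; first by exists 0; rewrite mul0r.
  move=> a _ _ [b ->] [c ->]; exists (a * b + c).
  by rewrite /GRing.scale /= mulrDl mulrA.
- by move=> [b b1]; apply: nb; exists b.
have hI := maximal_left_ideal_pred mI; have [_ nT _] := mI.
have yI : y \in I by move/jacobsonP: Jy; apply.
have I1 : 1 \in I.
  rewrite -[1](subrK y); apply: (smodD hI) => //; apply: LI.
  by exists 1; rewrite mul1r.
apply: nT => x; rewrite inE -[x]mulr1.
exact: (smodZ hI x I1).
Qed.

(** Let I be a stable power, so I I = I. If I is nonzero, take a minimal left ideal L with I L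
    nonzero, and b in L with I b nonzero. Then I b also qualifies, so b = c b with c in J; but 1 - c
    is left invertible. *)
Lemma jacobson_nilpotent : exists n, forall x, radical_power J n x -> x = 0.
Proof.
have hr x a : J x -> J (x * a) by apply: jacobson_mulr.
have desc n x : radical_power J n.+1 x -> radical_power J n x.
  elim: n x => [|n IH] x //.
  exact: (@radical_mul_mono A J A^o (radical_power J n.+1)).
have hS n : lideal (radical_power J n).
  by case: n => [|n] //; exact: smod_radical_mul.
have [n nP] := artA hS desc.
(* The exponent [n.+1] puts [I] inside [J] even when [n] is 0. *)
pose I := radical_power J n.+1.
have IP m x : (n <= m)%N -> I x -> radical_power J m x.
  by move=> nm /desc; apply: nP.
have IJ x : I x -> J x.
  move=> h; have h' := @radical_mul_mono A J A^o _ (fun=> True) _ x h.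
  exact: (@radical_mul_regular A J jacobson_smod hr x (h' _)).
have II (W : A -> Prop) x : lideal W ->
    (forall a s, I a -> I s -> W (a * s)) -> I x -> W x.
  move=> hW h Ix.
  have := IP (n.+1 + n.+1)%N x (leq_trans (leqnSn n) (leq_addr _ _)) Ix.
  rewrite /radical_power iterD; exact: (@iter_radical_mul A J hr _ A^o).
exists n.+1 => x0 Ix0; apply: contrapT => x00.
have [||L [[lL [a [b [Ia [Lb ab]]]]] min]] :=
  @artinian_min (fun L => lideal L /\ exists a b, I a /\ (L b /\ a * b <> 0)) I.
- by move=> L [].
- split; first exact: hS.
  apply: contrapT => no; apply: x00; apply: (II (fun x => x = 0)) Ix0.
    by split=> // a u v -> ->; rewrite /GRing.scale /= mulr0 addr0.
  by move=> a s Ia Is; apply: contrapT => as0; apply: no; exists a, s.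
have annW : lideal (fun x => x * b = 0).
  split; first by rewrite mul0r.
  by move=> c u v u0 v0; rewrite mulrDl -mulrA u0 v0 mulr0 addr0.
have [|| c [Ic bE]] := min (fun x => exists c, I c /\ x = c * b) _ _ b Lb.
- split.
    split; first by exists 0; rewrite mul0r; split=> //; exact: smod0 (hS n.+1).
    move=> d _ _ [c [Ic ->]] [c' [Ic' ->]]; exists (d * c + c'); split.
      by case: (hS n.+1) => _; apply.
    by rewrite /GRing.scale /= mulrDl mulrA.
  apply: contrapT => no; apply: ab.
  apply: (II (fun x => x * b = 0)) Ia => // c d Ic Id.
  apply: contrapT => cdb; apply: no; exists c, (d * b); split=> //; split.
    by exists d.
  by rewrite mulrA.
- by move=> _ [c [_ ->]]; exact: (smodZ lL).
have [d dc] := jacobson_left_inverse (IJ _ Ic).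
apply: ab; rewrite -[b]mul1r -dc -mulrA mulrBl mul1r -bE subrr mulr0.
by rewrite mulr0.
Qed.

(** Take [L'] minimal among the left ideals containing [J] with L + L' = A. The intersection of L
    and L' lies in each maximal left ideal, since otherwise intersecting [L'] with that ideal would
    give a smaller supplement. Writing 1 = e + f then puts a - a e = a f in [J] for [a] in [L]. *)
Lemma jacobson_semisimple : semisimple_modulo J.
Proof.
move=> L hL JL.
have [||L' [[hL' JL' sum] min]] := @artinian_min (fun L' => [/\ lideal L',
    forall x, J x -> L' x & forall y, exists a b, [/\ L a, L' b & y = a + b]])
    (fun=> True).
- by move=> M [].
- split=> // y; exists 0, y; split=> //; first exact: smod0 hL.
  by rewrite add0r.
have LLJ x : L x -> L' x -> J x.
  move=> Lx L'x; apply/jacobsonP => I mI.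
  apply: contrapT => /negP xI; have hI := maximal_left_ideal_pred mI.
  suff : x \in I by move/negP: xI.
  have [|y [Iy //]|y L'y] := min (fun y => L' y /\ y \in I) _ _ x L'x => //.
  split.
  - split; first by split; [exact: smod0 hL'|exact: smod0 hI].
    move=> a u v [L'u uI] [L'v vI]; split; first by case: hL' => _; apply.
    by case: hI => _; apply.
  - by move=> y Jy; split; [exact: JL'|move/jacobsonP: Jy; apply].
  move=> y; have [c [d [Lc L'd ->]]] := sum y.
  have [a [z [zI dE]]] := maximal_left_idealP mI xI d.
  exists (c + a * x), z; split.
  - by apply: (smodD hL) => //; exact: (smodZ hL).
  - split=> //; have -> : z = d - a * x by rewrite dE addrC addKr.
    by apply: (smodB hL') => //; exact: (smodZ hL').
  - by rewrite -addrA -dE.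
have [e [f [Le L'f ef]]] := sum 1.
exists e; split=> // a La.
have -> : a - a * e = a * f by rewrite -{1}[a]mulr1 ef mulrDr addrC addKr.
apply: LLJ; last exact: (smodZ hL').
have -> : a * f = a - a * e by rewrite -{2}[a]mulr1 ef mulrDr addrC addKr.
by apply: (smodB hL) => //; exact: (smodZ hL).
Qed.

(** The Hopkins-Levitzki argument. A minimal [K] equals J L, so [L] is finitely generated modulo J
    L. Hence every element of [L] is, for each m, congruent to one of J^m L modulo the span of the
    generators, and J is nilpotent. *)
Lemma artinian_noetherian : noetherian_ring A.
Proof.
move=> L hL.
have hr x a : J x -> J (x * a) by apply: jacobson_mulr.
have [n nilJ] := jacobson_nilpotent; have ssJ := jacobson_semisimple.
pose JL := @radical_mul A J A^o L.
have hJL : lideal JL by exact: smod_radical_mul.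
have JLL x : JL x -> L x by exact: radical_mul_sub.
pose fin (K : A -> Prop) := exists (F : finType) (g : F -> A),
  (forall i, L (g i)) /\
  forall y, L y -> exists k s, K k /\ y = k + \sum_i s i * g i.
have [||K [[hK JK KL [F [g [gL gP]]]] min]] := @artinian_min (fun K =>
    [/\ lideal K, forall x, JL x -> K x, forall x, K x -> L x & fin K]) L.
- by move=> K [].
- split=> //; exists void, (fun v : void => match v with end).
  split; first by case.
  move=> y Ly; exists y, (fun v : void => match v with end); split=> //.
  by rewrite big1 ?addr0 // => -[].
have KJ x : K x -> JL x.
  move=> Kx; apply: contrapT => nx.
  have [KT [k [ki kP]]] := submodule_ex hK.
  (* [M] is a copy of (A x + J L) / J L, onto which [t] retracts [K]. The kernel of [t] competes
     with [K], as [x] can join the generators; minimality puts [x] in this kernel, hence in J L. *)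
  have [|M [q [qs qP]]] := @quotient_ex A A^o (fun a => JL (a * x)).
    split; first by rewrite mul0r; exact: smod0 hJL.
    by move=> a u v hu hv; rewrite mulrDl -mulrA; case: hJL => _; apply.
  have [|||t tP] := @semisimple_extend A J ssJ KT M (fun y m => exists a z,
      [/\ JL z, k y = a * x + z & m = q a]).
  - split.
      exists 0, 0; split; [exact: smod0 hJL| |]; rewrite linear0 //.
      by rewrite mul0r addr0.
    move=> a y _ y' _ [b [z [hz yE ->]]] [b' [z' [hz' yE' ->]]].
    exists (a * b + b'), (a * z + z'); split.
    + by case: hJL => _; apply.
    + rewrite linearP yE yE' /GRing.scale /= mulrDr mulrDl mulrA.
      by rewrite addrACA.
    + by rewrite -linearP.
  - move=> _ [a [z [hz /esym /eqP e ->]]]; apply/qP; move: e.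
    rewrite linear0 addr_eq0 => /eqP ->; exact: (smodN hJL).
  - move=> a y Ja; exists 0, (a * k y); split.
    + by apply: (@radical_mulP A J A^o) => //; apply/KL/kP; exists y.
    + by rewrite mul0r add0r linearZ.
    + by rewrite linear0.
  have [x' x'E] := proj1 (kP x) Kx.
  have tx a : t (a *: x') = q a.
    apply: tP; exists a, 0; split=> //; first exact: smod0 hJL.
    by rewrite addr0 linearZ x'E.
  apply: nx; rewrite -[x]mul1r; apply/qP; rewrite -tx scale1r.
  have [||y [yE ty]] := min (fun y => exists w, k w = y /\ t w = 0) _ _ x Kx.
  - split.
    + split; first by exists 0; rewrite !linear0.
      move=> a _ _ [u [<- tu]] [v [<- tv]]; exists (a *: u + v).
      by rewrite !linearP tu tv scaler0 addr0.
    + move=> z hz; have [w wE] := proj1 (kP z) (JK _ hz); exists w; split=> //.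
      by rewrite (tP w 0) //; exists 0, z; rewrite mul0r add0r linear0.
    + by move=> _ [w [<- _]]; apply/KL/kP; exists w.
    exists (unit + F)%type, (fun i => if i is inr i then g i else x).
    split; first by case=> // _; exact: KL.
    move=> y /gP [z [s [Kz yE]]]; have [w wE] := proj1 (kP z) Kz.
    have [a aE] := qs (t w).
    exists (z - a * x), (fun i => if i is inr i then s i else a); split.
      exists (w - a *: x'); rewrite !linearB tx aE subrr; split=> //.
      by rewrite linearZ wE x'E.
    rewrite big_sumType /= (bigD1 tt) //= big1 ?addr0; last by case.
    by rewrite addrA subrK.
  - by move=> _ [w [<- _]]; apply/kP; exists w.
  by have -> : x' = y by apply: ki; rewrite yE x'E.
exists F, g => b.
pose sp y := exists s : F -> A, y = \sum_i s i * g i.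
have hsp : lideal sp.
  split; first by exists (fun=> 0); rewrite big1 // => i _; rewrite mul0r.
  move=> a _ _ [s ->] [s' ->]; exists (fun i => a * s i + s' i).
  rewrite scaler_sumr -big_split; apply: eq_bigr => i _ /=.
  by rewrite /GRing.scale /= mulrDl mulrA.
split; last first.
  by move=> [s ->]; apply: (@smod_sum A A^o _ hL) => i _; exact: (smodZ hL).
pose P m := iter m (@radical_mul A J A^o) L.
have step m x : P m x -> exists y, P m.+1 y /\ sp (x - y).
  elim: m x => [|m IH] x.
    move=> /gP [y [s [/KJ hy ->]]]; exists y; split=> //.
    by rewrite addrC addKr; exists s.
  move=> hx; apply: (hx (fun x => exists y, P m.+2 y /\ sp (x - y))).
    have [h0 hl] := @smod_radical_mul A J A^o (P m.+1).
    split; first by exists 0; split=> //; rewrite subrr; exact: smod0 hsp.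
    move=> a u v [y [hy uy]] [z [hz vz]]; exists (a *: y + z : A^o); split.
      exact: hl.
    rewrite opprD addrACA -scalerBr; case: hsp => _; exact.
  move=> a z Ja /IH [y [hy zy]]; exists (a * y); split.
    exact: (@radical_mulP A J A^o).
  by rewrite -[_ *: _]/(a * z) -mulrBr; exact: (smodZ hsp).
have all m x : L x -> exists y, P m y /\ sp (x - y).
  move=> Lx; elim: m => [|m [y [hy xy]]].
    by exists x; split=> //; rewrite subrr; exact: smod0 hsp.
  have [z [hz yz]] := step m y hy; exists z; split=> //.
  by rewrite -(subrK y x) -addrA; exact: (smodD hsp).
move=> /(all n) [y [hy]]; suff -> : y = 0 by rewrite subr0.
apply: (@iter_radical_mul A J hr n A^o L (fun y => y = 0)) hy.
  by split=> // a u v -> ->; rewrite scaler0 addr0.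
by move=> a s /nilJ -> _; rewrite scale0r.
Qed.

End Artinian.

(** * Artin algebras *)

Section ArtinAlgebra.
Variables (R : comPzRingType) (A : pzRingType) (phi : {rmorphism R -> A}).
Hypothesis hA : artin_algebra phi.

Definition R_submodule (N : A -> Prop) :=
  N 0 /\ forall r x y, N x -> N y -> N (phi r * x + y).

Fixpoint R_span (s : seq A) (y : A) : Prop :=
  if s is x :: s' then exists r v, R_span s' v /\ y = phi r * x + v else y = 0.

Lemma R_submodule_span s : R_submodule (R_span s).
Proof.
elim: s => [|x s [S0 Sl]] /=.
  by split=> // r x y -> ->; rewrite mulr0 addr0.
split; first by exists 0, 0; rewrite rmorph0 mul0r addr0.
move=> r _ _ [a [v [hv ->]]] [b [w [hw ->]]].
exists (r * a + b), (phi r * v + w); split; first exact: Sl.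
by rewrite rmorphD rmorphM /= mulrDr mulrDl mulrA addrACA.
Qed.

Lemma R_submoduleB N x y : R_submodule N -> N x -> N y -> N (x - y).
Proof.
case=> N0 Nl Nx Ny; have := Nl (-1) _ _ Ny Nx.
by rewrite rmorphN rmorph1 mulN1r addrC.
Qed.

Lemma R_submoduleD N x y : R_submodule N -> N x -> N y -> N (x + y).
Proof. by case=> _ Nl Nx Ny; have := Nl 1 _ _ Nx Ny; rewrite rmorph1 mul1r. Qed.

(** Finitely generated modules over an artinian ring are artinian: a chain stabilizes once its
    ideals of coefficients at the head generator [x] and its intersections with the span of the
    others do. *)
Lemma R_span_stable s (N : nat -> A -> Prop) :
  (forall n, R_submodule (N n)) -> (forall n x, N n.+1 x -> N n x) ->
  (forall x, N 0%N x -> R_span s x) ->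
  exists n, forall m, (n <= m)%N -> forall x, N n x -> N m x.
Proof.
elim: s N => [|x s IH] N hN desc sub.
  by exists 0%N => m _ x /sub ->; case: (hN m).
have descD m n y : (n <= m)%N -> N m y -> N n y.
  move=> nm; rewrite -(subnK nm); elim: (m - n)%N => [|k IHk] //.
  by rewrite addSn => /desc.
have [S0 Sl] := R_submodule_span s.
pose I n : {pred R} :=
  fun r => `[< exists v, R_span s v /\ N n (phi r * x + v) >].
have hI n : left_ideal (I n).
  have [N0 Nl] := hN n; split.
    by apply/asboolP; exists 0; rewrite rmorph0 mul0r addr0.
  move=> a b c /asboolP [v [hv Nv]] /asboolP [w [hw Nw]].
  apply/asboolP; exists (phi a * v + w); split; first exact: Sl.
  rewrite /GRing.scale /= rmorphD rmorphM mulrDl addrACA -mulrA -mulrDr.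
  exact: Nl.
have [n1 n1P] : exists n, forall m, (n <= m)%N -> I m =i I n.
  case: hA => art _ _; apply: art => // n r /asboolP [v [hv /desc Nv]].
  by apply/asboolP; exists v.
have [||//|n2 n2P] := IH (fun n y => R_span s y /\ N n y).
- move=> n; have [N0 Nl] := hN n; split=> // r y z [hy Ny] [hz Nz].
  by split; [apply: Sl | apply: Nl].
- by move=> n y [hy /desc].
- by move=> y [].
exists (maxn n1 n2) => m; rewrite geq_max => /andP [m1 m2] y Ny.
have [r [v [hv yE]]] : R_span (x :: s) y.
  by apply: sub; apply: descD Ny.
have /asboolP [w [hw Nw]] : r \in I m.
  rewrite (n1P m m1) -(n1P (maxn n1 n2)) ?leq_maxl //.
  by apply/asboolP; exists v; rewrite -yE.
have -> : y = (phi r * x + w) + (v - w).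
  by rewrite yE addrACA subrr addr0.
apply: (R_submoduleD (hN m)) => //.
have N2 : R_span s (v - w) /\ N n2 (v - w).
  split; first exact: R_submoduleB (R_submodule_span s) hv hw.
  have -> : v - w = y - (phi r * x + w) by rewrite yE opprD addrACA subrr add0r.
  apply: (R_submoduleB (hN n2)); [apply: descD Ny|apply: descD Nw] => //.
  exact: leq_maxr.
exact: (proj2 (n2P m m2 _ N2)).
Qed.

Lemma R_submodule_stable (N : nat -> A -> Prop) :
  (forall n, R_submodule (N n)) -> (forall n x, N n.+1 x -> N n x) ->
  exists n, forall m, (n <= m)%N -> forall x, N n x -> N m x.
Proof.
move=> hN desc; have [_ _ [n [g gP]]] := hA.
apply: (@R_span_stable [seq g i | i <- index_enum 'I_n]) => // x _.
have [c ->] := gP x; elim: (index_enum _) => [|i s IH] /=.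
  by rewrite big_nil.
by rewrite big_cons; exists (c i), (\sum_(i <- s) phi (c i) * g i).
Qed.

Lemma artin_algebra_artinian : left_artinian A.
Proof.
move=> I hI desc; apply: R_submodule_stable => // n.
by case: (hI n) => I0 Il; split=> // r x y; apply: Il.
Qed.

Lemma artin_algebra_artinian_op : left_artinian A^c.
Proof.
move=> I hI desc; apply: (@R_submodule_stable I) => // n.
case: (hI n) => I0 Il; split=> // r x y Ix Iy.
have [_ central _] := hA; rewrite central.
exact: (Il (phi r) x y).
Qed.

End ArtinAlgebra.

(** * Left-right symmetry of the radical *)

Section JacobsonOpposite.

(** If [x] is outside a maximal right ideal [I], then 1 = x a + z with z in I. The element y = x a
    is nilpotent, and 1 - y in I gives 1 - y^n in I for all n, so 1 is in I. *)
Lemma jacobson_sub_op (A : pzRingType) x :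
  left_artinian A -> x \in jacobson A -> x \in jacobson A^c.
Proof.
move=> art Jx; apply/jacobsonP => I mI; apply: contrapT => /negP xI.
have hI := maximal_left_ideal_pred mI.
have [a [z [zI zE]]] := maximal_left_idealP mI xI 1.
pose y : A := x * a.
have Jy : y \in jacobson A by apply: jacobson_mulr.
have powI n : (1 - y ^+ n : A) \in I.
  elim: n => [|n IH]; first by rewrite expr0 subrr; exact: smod0 hI.
  have -> : 1 - y ^+ n.+1 = (1 - y) * y ^+ n + (1 - y ^+ n).
    by rewrite mulrBl mul1r exprS [RHS]addrC addrA subrK.
  apply: (smodD hI) => //.
  have zy : (1 - y : A) = z.
    by rewrite [X in X - _](zE : (1 : A) = y + z) addrC addKr.
  rewrite zy; exact: (smodZ hI (y ^+ n : A) zI).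
have [n nP] := jacobson_nilpotent art.
have Jl := jacobson_smod A.
have yn : y ^+ n = 0.
  apply: nP; elim: (n) => [|m IH] //; rewrite exprSr.
  exact: (@radical_power_mulr A _ Jl).
case: mI => _ nT _; apply: nT => b; rewrite inE.
have I1 : (1 : A) \in I by have := powI n; rewrite yn subr0.
by rewrite -[b]mulr1; exact: (smodZ hI (b : A) I1).
Qed.

Lemma jacobson_op (A : pzRingType) :
  left_artinian A -> left_artinian A^c -> jacobson A = jacobson A^c.
Proof.
move=> art art'; apply/funext => x; apply/idP/idP.
  exact: jacobson_sub_op.
move=> /(@jacobson_sub_op A^c x art').
by [].
Qed.

End JacobsonOpposite.

(* The two ring structures differ only in the proofs of the axioms. *)
Lemma converseK (A : pzRingType) : ((A^c)^c : pzRingType) = A.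
Proof.
case: A => T [m1 m2 m3 m4 m5 m6 m7 m8 m9 m10].
set B := (X in _ = X).
suff e : GRing.PzRing.GRing_Nmodule_isPzSemiRing_mixin
    (GRing.PzRing.class ((B^c)^c : pzRingType)) = m10.
  exact: (congr1 (fun m => GRing.PzRing.Pack (GRing.PzRing.Class m6 m)) e).
rewrite {}/B; case: m10 => o mul a1 a2 a3 a4 a5 a6 a7.
cbn.
congr GRing.Nmodule_isPzSemiRing.Axioms_; exact: Prop_irrelevance.
Qed.

(** * Comparison of the dimensions *)

Section Dimensions.

Definition ole (x y : option nat) : bool :=
  if y is Some n then (if x is Some m then (m <= n)%N else false) else true.

Lemma ole_anti x y : ole x y -> ole y x -> x = y.
Proof.
case: x y => [m|] [n|] //= mn nm; congr Some.
by apply/eqP; rewrite eqn_leq mn nm.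
Qed.

Lemma codimP (A : pzRingType) (P : lmodType A -> Prop) M n :
  codim P M = Some n -> coresolution P M n.
Proof.
rewrite /codim; case: pselect => // h [<-].
by case: ex_minnP => m /asboolP.
Qed.

Lemma codim_le (A : pzRingType) (P : lmodType A -> Prop) M n :
  coresolution P M n -> ole (codim P M) (Some n).
Proof.
move=> h; rewrite /codim; case: pselect => [h'|[]]; last by exists n.
by case: ex_minnP => m _ min; apply/min/asboolP.
Qed.

Lemma codim_ole (A B : pzRingType) (P : lmodType A -> Prop) M
    (Q : lmodType B -> Prop) N :
  (forall n, coresolution P M n -> coresolution Q N n) ->
  ole (codim Q N) (codim P M).
Proof.
move=> h; case e: (codim P M) => [n|] //; exact/codim_le/h/codimP.
Qed.

Section Radical.
Variable A : pzRingType.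
Hypotheses (artA : left_artinian A) (artAc : left_artinian A^c).
Local Notation J := (fun x : A => x \in jacobson A).

Lemma Ginjdim_le_injdim_regular (M : lmodType A) :
  injdim A^o = injdim (A^c)^o -> ole (Ginjdim M) (injdim A^o).
Proof.
case e: (injdim A^o) => [n|] e'; last by case: (Ginjdim M).
apply/codim_le/cores_coresolution.
have /coresolution_cores/cores_injective [G0 [AG0 hG0]] := codimP e.
have /coresolution_cores/cores_injective [G1 [AG1 hG1]] := codimP (esym e').
have [G MG] := csyz_ex n M.
apply: (csyz_cores_gorenstein MG); apply: csyz_gorenstein MG.
  move=> X G'.
  apply: (csyz_projective_injective (artinian_noetherian artA) AG0 hG0).
  exact: Fr_projective.
move=> E hE.
have Jr x a : J x -> J (x * a) by apply: jacobson_mulr.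
have [|K [D [u hD]]] := resolution_ex (artinian_noetherian artAc) (L := J).
  by have [] := jacobson_right A.
apply: (tor_res_radical (jacobson_smod A) Jr (jacobson_nilpotent artA)
  (jacobson_semisimple artA) hD).
exact: (injective_tor_res AG1 hG1 hD hE).
Qed.

Variables (RJ : lmodType A) (j : {linear RJ -> A^o}).
Hypothesis ji : injective j.
Hypothesis jP : forall a, J a <-> exists y, j y = a.

(** Stating this for any [RJ] with image [J] covers the right radical over [A^c], whose carrier is
    given by [jacobson A] and not by [jacobson A^c]. *)
Lemma injdim_op_le_Ginjdim_radical : ole (injdim (A^c)^o) (Ginjdim RJ).
Proof.
apply: codim_ole => n /coresolution_cores hRJ.
apply/cores_coresolution/cores_injective.
have [G AG] := csyz_ex n (A^c)^o; exists G; split=> //.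
apply: (csyz_regular_injective (artinian_noetherian artAc) _ AG) => E hE.
have Jr x a : J x -> J (x * a) by apply: jacobson_mulr.
apply: (ext1_radical_projective (jacobson_smod A) Jr (jacobson_nilpotent artA)
  (jacobson_semisimple artA) ji jP).
by rewrite -[n]addn0; exact: cores_gorenstein_ext1 hRJ hE.
Qed.

End Radical.

Lemma radical_embedding_ex (A : pzRingType) (S : {pred A})
    (hS : @submod_closed A A^o S) :
  exists j : {linear submodule hS -> A^o},
    injective j /\ forall a, a \in S <-> exists y, j y = a.
Proof.
have [//|j jE] := @linear_of_fun A (submodule hS) A^o (fun x => val x).
exists j; split; first by move=> x y; rewrite !jE => /val_inj.
move=> a; split=> [aS|[y <-]]; last by rewrite jE; exact: (valP y).
by exists (exist _ a aS : submodule hS); rewrite jE.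
Qed.

End Dimensions.

Theorem proposition4p3 (R : comPzRingType) (A : pzRingType)
    (phi : {rmorphism R -> A}) (hA : artin_algebra phi) :
  (injdim A^o = injdim (A^c)^o
   <->
   (Ginjdim (radical_left A) = injdim A^o /\
    Ginjdim (radical_right A) = injdim (A^c)^o))
  /\
  (injdim A^o = injdim (A^c)^o ->
   Ginjdim (radical_left A) = Ginjdim (radical_right A)).
Proof.
have art := artin_algebra_artinian hA.
have artc := artin_algebra_artinian_op hA.
(* The mirrored inequalities have base ring [A^c] and mention [(A^c)^c]; facts depending on the ring
   alone are transported along its equality with [A]. *)
have artcc : left_artinian (A^c)^c := eq_ind_r left_artinian art (converseK A).
have idcc : injdim ((A^c)^c)^o = injdim A^o :=
  congr1 (fun B : pzRingType => injdim B^o) (converseK A).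
have [j [ji jP]] := radical_embedding_ex (jacobson_left A).
have [j' [ji' jP']] := radical_embedding_ex (jacobson_right A).
have jP2 a : a \in jacobson A^c <-> exists y, j' y = a.
  by rewrite -(jacobson_op art artc); exact: jP'.
have le1 := injdim_op_le_Ginjdim_radical art artc ji jP.
have le2 := injdim_op_le_Ginjdim_radical artc artcc ji' jP2.
have le3 := Ginjdim_le_injdim_regular art artc (radical_left A).
have le4 := Ginjdim_le_injdim_regular artc artcc (radical_right A).
rewrite idcc in le2 le4.
have eqs : injdim A^o = injdim (A^c)^o ->
    Ginjdim (radical_left A) = injdim A^o /\
    Ginjdim (radical_right A) = injdim (A^c)^o.
  move=> e; split; first by apply: ole_anti (le3 e) _; rewrite e.
  by apply: ole_anti (le4 (esym e)) _; rewrite -e.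
split; last by move=> e; have [-> ->] := eqs e.
split=> // -[e e']; apply: ole_anti.
  by rewrite -e'; exact: le2.
by rewrite -e; exact: le1.
Qed.
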